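(* Suppose that $C$ is a (symmetric) positive definite $p\times p$ matrix, and that we are given $X_1,\dots,X_n$ drawn independently from a Gaussian probability distribution $P$ with mean $m_{10}$ and covariance $C$ on $\mathbb{R}^p$. Let $\bar m_{10}$ be the associated empirical mean. Let us take $\hat F_{10}=C^{-1}\bar m_{10}$ and $\hat s_{10}=s_{10}$. Then the classification rule $1_{\hat V}$, where $\hat V=\{x\in\mathbb{R}^p:\langle \hat F_{10},x-\hat s_{10}\rangle_{\mathbb{R}^p}\ge0\}$, leads to $$\mathbb{E}_{P^{\otimes n}}[\mathcal{R}(1_{\hat V})]\ge\frac{\arccos\left(\frac{1}{\sqrt{p-3}}\big(\sqrt n\,\|F_{10}\|_{L_2(\gamma_C)}+1\big)\right)}{2\pi}\,e^{-\frac{\|F_{10}\|^2_{L_2(\gamma_C)}}{8}}.$$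
   Context: The two classes have distributions $P_1$ and $P_0$, the Gaussian measures on $\mathbb{R}^p$ with common covariance $C$ and respective means $\mu_1$ and $\mu_0$; $m_{10}=\mu_1-\mu_0$, $s_{10}=\frac{\mu_1+\mu_0}{2}$, $F_{10}=C^{-1}m_{10}$. With $V=\{x\in\mathbb{R}^p:\langle F_{10},x-s_{10}\rangle_{\mathbb{R}^p}\ge0\}$ (the optimal rule being $1_V$), the learning error of the rule $1_{\hat V}$ is $\mathcal{R}(1_{\hat V})=\frac12\big(P_1(X\in V\setminus\hat V)+P_0(X\in\hat V\setminus V)\big)$, where $\hat V$ is held fixed in these probabilities (i.e. they are conditional on the sample $X_1,\dots,X_n$); $\mathbb{E}_{P^{\otimes n}}$ is the expectation over the sample. $\gamma_C$ is the centred Gaussian measure on $\mathbb{R}^p$ with covariance $C$, and for $F\in\mathbb{R}^p$, $\|F\|_{L_2(\gamma_C)}$ is the $L_2(\gamma_C)$ norm of the linear map $x\mapsto\langle F,x\rangle_{\mathbb{R}^p}$, so that $\|F\|_{L_2(\gamma_C)}=\|C^{1/2}F\|_{\mathbb{R}^p}$. *)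

(* Defs.v *)
From HB Require Import structures.
From mathcomp Require Import all_boot all_order all_algebra.
From mathcomp Require Import all_classical all_reals all_analysis.

Set Implicit Arguments.
Unset Strict Implicit.
Unset Printing Implicit Defensive.
Import Order.TTheory GRing.Theory Num.Theory.
Import numFieldNormedType.Exports.

Local Open Scope classical_set_scope.
Local Open Scope ring_scope.

Section product_prob.
Context d (T : measurableType d) (R : realType).

Definition tuple_cons n (x : T * n.-tuple T) : n.+1.-tuple T :=
  [the n.+1.-tuple T of x.1 :: x.2].

Lemma measurable_tuple_cons n :
  measurable_fun [set: T * n.-tuple T] (@tuple_cons n).
Proof. by apply: measurable_cons; [exact: measurable_fst|exact: measurable_snd]. Qed.

HB.instance Definition _ n :=
  isMeasurableFun.Build _ _ _ _ (@tuple_cons n) (@measurable_tuple_cons n).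

(* The law of n independent draws from P; see product_prob_rect. *)
Fixpoint product_prob (P : probability T R) n : probability (n.-tuple T) R :=
  if n is n'.+1 then distribution (P \x product_prob P n')%E (@tuple_cons n')
  else \d_[tuple].

Lemma product_prob_rect (P : probability T R) n (A : 'I_n -> set T) :
  (forall i, measurable (A i)) ->
  product_prob P n [set x | forall i, A i (tnth x i)] = (\prod_(i < n) P (A i))%E.
Proof.
elim: n A => [|n IHn] A mA.
  by rewrite big_ord0 /= diracE mem_set// => -[].
rewrite big_ord_recl -IHn// -product_measure1E//=; last first.
  rewrite [X in measurable X](_ : _ = \bigcap_(i in [set: 'I_n])
      ((fun x : n.-tuple T => tnth x i) @^-1` A (lift ord0 i))); last first.
    by apply/seteqP; split=> [x /= h i _|x h i /=]; [exact: h|exact: (h i)].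
  apply: fin_bigcap_measurable => // i _.
  by rewrite -[X in measurable X]setTI; exact: measurable_tnth.
rewrite /distribution /pushforward; congr (_ _).
apply/seteqP; split=> [[a x]/= h|[a x]/= [Aa h] i].
  split=> [|i]; first exact: (h ord0).
  by have := h (lift ord0 i); rewrite tnthS.
by have [j ->|->//] := unliftP ord0 i; rewrite tnthS.
Qed.

End product_prob.

(* R^p is p.-tuple R as a measurable space and 'cV[R]_p as a vector space. *)
Section gaussian_classification.
Context {R : realType} {p : nat}.

Definition vec_of_tuple (x : p.-tuple R) : 'cV[R]_p := \col_i tnth x i.

Definition tuple_of_vec (v : 'cV[R]_p) : p.-tuple R := [tuple v i 0 | i < p].

Definition dotv (u v : 'cV[R]_p) : R := \sum_(i < p) u i 0 * v i 0.

Definition posdef (C : 'M[R]_p) : Prop :=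
  C^T = C /\ forall u : 'cV[R]_p, u != 0 -> 0 < dotv u (C *m u).

(* Any two factorisations C = A A^T give the same law of m + A Z. *)
Definition gaussian (m : 'cV[R]_p) (C : 'M[R]_p)
    (P : probability (p.-tuple R) R) : Prop :=
  exists2 A : 'M[R]_p, A *m A^T = C &
    forall B, measurable B ->
      P B = pushforward (product_prob (normal_prob (0 : R) 1) p)
              (fun z => tuple_of_vec (m + A *m vec_of_tuple z)) B.

Definition L2norm (gamma : probability (p.-tuple R) R) (F : 'cV[R]_p) : R :=
  fine ('N[gamma]_2%:E[(fun x => (dotv F (vec_of_tuple x))%:E)])%E.

Definition halfspace (F s : 'cV[R]_p) : set (p.-tuple R) :=
  [set x | 0 <= dotv F (vec_of_tuple x - s)].

Definition learning_error (P1 P0 : probability (p.-tuple R) R)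
    (V Vhat : set (p.-tuple R)) : R :=
  2^-1 * (fine (P1 (V `\` Vhat)) + fine (P0 (Vhat `\` V))).

Definition empirical_mean n (X : n.-tuple (p.-tuple R)) : 'cV[R]_p :=
  n%:R^-1 *: \sum_(i < n) vec_of_tuple (tnth X i).

End gaussian_classification.

(* Outside [-1, 1] the value of acos is the default element 0. *)
Lemma acos_gt1 (R : realType) (x : R) : 1 < x -> acos x = 0.
Proof.
move=> x1; rewrite unlock /acos; case: xgetP => //= y _ [_ cosyx].
by have := cos_le1 y; rewrite cosyx leNgt x1.
Qed.

(* Main.v *)
Require Import Defs.
From mathcomp Require Import all_boot all_order all_algebra.
From mathcomp Require Import all_classical all_reals all_analysis.
From mathcomp Require Import measurable_realfun.
From mathcomp Require Import ring lra.

(** The argument is geometric once the coordinates are whitened.  Write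
    [C = B B^T] with [B] chosen, by composing any factor of [C] with a
    reflection, so that [B^-1 m10 = L e1] with [L >= 0] ([whitening]); then
    [L] is the L2 norm of [F10] ([L2norm_gaussian]).  In the coordinate
    [y = B^-1 (x - s10)] the two classes are standard Gaussian vectors
    translated by [L e1 / 2] and [- L e1 / 2], the optimal half-space is
    [y1 >= 0], and the estimated one is [u . y >= 0] with [u] the whitened
    sample mean.

    Fix the sample.  A misclassification event is then, up to the symmetry
    [y |-> - y], the wedge [y1 > 0, u . y < 0].  By the Cameron-Martin
    formula, translating by [L e1 / 2] multiplies the Gaussian density by
    [exp (L y1 / 2 - L^2 / 8)], which is at least [exp (- L^2 / 8)] on that
    wedge ([gauss_wedge_lb]).  The wedge depends on two orthogonal
    coordinates only, so its centred mass is its angle over [2 pi]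
    ([normal_sector], [gaussian_sector]).  Hence the learning error is at
    least [exp (- L^2 / 8)] times the angle between [u] and [e1], over [2 pi]
    ([learning_error_lb]).

    Up to a positive factor, which does not change directions, [u] has the
    law of [sqrt n L e1 + z] with [z] standard Gaussian ([sample_sum_law]).
    Its angle with [e1] is at least
    [pi / 2 - atan (|sqrt n L + z1| / |z'|)], [z'] being the last [p - 1]
    coordinates of [z].  As [atan] is concave on the nonnegative reals, Jensen's
    inequality bounds the expected angle below by
    [pi / 2 - atan (E |sqrt n L + z1| E (1 / |z'|))], where [E |z1| <= 1] and
    [E (1 / |z'|) <= (p - 3)^(-1/2)] ([gauss_int_inv_sqr],
    [gauss_int_angle]).  Finally [pi / 2 - atan b >= acos b] for [b >= 0]
    ([acos_le_atan]).

    Everything used about Gaussian vectors comes from the one-dimensional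
    translation formula [normal_prob_shift] and Tonelli's theorem: the
    formula tensorises ([gauss_int_shift]) and implies rotation invariance
    ([gauss_int_orth]), whence the laws of linear forms and of sums. *)

Set Implicit Arguments.
Unset Strict Implicit.
Unset Printing Implicit Defensive.
Import Order.TTheory GRing.Theory Num.Theory.
Import numFieldNormedType.Exports.

Local Open Scope classical_set_scope.
Local Open Scope ring_scope.

(** * Integration *)

(** Structural recursion on the shape of the function, which plain [apply:]
    cannot follow: the head operations have to be abstracted by hand. *)
Ltac measurable_auto := solve [done] || solve [assumption] || (lazymatch goal with
  | |- measurable_fun _ (fun x => EFin (@?f x)) =>
      apply/measurable_EFinP; rewrite /comp /=; measurable_auto
  | |- measurable_fun _ (fun x => GRing.mul (@?f x) (@?g x)) =>
      apply: measurable_funM; measurable_auto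
  | |- measurable_fun _ (fun x => mule (@?f x) (@?g x)) =>
      apply: emeasurable_funM; measurable_auto
  | |- measurable_fun _ (fun x => Algebra.add (@?f x) (@?g x)) =>
      first [apply: measurable_funD; measurable_auto
            | apply: emeasurable_funD; measurable_auto]
  | |- measurable_fun _ (fun x => ?f (@?g x)) =>
      apply: (measurableT_comp (f := f)); measurable_auto
  | |- measurable_fun _ (normal_pdf _ _) => exact: measurable_normal_pdf
  | |- measurable_fun _ (comp ?f ?g) => rewrite /comp /=; measurable_auto
  end).

Section integration_tools.
Context d (T : measurableType d) (R : realType).

(** The integral of a nonnegative function is a supremum over the simple
    functions below it, so monotonicity holds for functions that are not
    measurable.  This is what allows the learning error to be bounded inside
    the expectation without measurability in the sample. *)
Lemma ge0_le_integralT (nu : {measure set T -> \bar R})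
    (f g : T -> \bar R) : (forall x, 0 <= f x)%E -> (forall x, f x <= g x)%E ->
  (\int[nu]_x f x <= \int[nu]_x g x)%E.
Proof.
move=> f0 fg; rewrite !ge0_integralTE//; last first.
  by move=> x; exact: le_trans (fg x).
by apply: le_ereal_sup => _ [h hf <-]; exists h => // x; exact: le_trans (fg x).
Qed.

Lemma integral_boolM (nu : {measure set T -> \bar R})
    (b : T -> bool) (f : T -> \bar R) :
  (\int[nu]_x ((b x)%:R%:E * f x) = \int[nu]_(x in [set x | b x]) f x)%E.
Proof.
rewrite [RHS]integral_mkcond; apply: eq_integral => x _; rewrite patchE.
case: ifPn => [/set_mem/= ->|]; first by rewrite mul1e.
by rewrite notin_setE/= => /negP/negbTE ->; rewrite mul0e.
Qed.

Lemma integral_bool (nu : {measure set T -> \bar R})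
    (b : T -> bool) : measurable [set x | b x] ->
  (\int[nu]_x (b x)%:R%:E = nu [set x | b x])%E.
Proof.
move=> mb; transitivity (\int[nu]_x ((b x)%:R%:E * cst 1%E x))%E.
  by apply: eq_integral => x _; rewrite mule1.
by rewrite integral_boolM integral_cst// mul1e.
Qed.

Lemma measurable_boolR (b : T -> bool) :
  measurable_fun setT b -> measurable_fun setT (fun x => (b x)%:R : R).
Proof.
move=> mb; rewrite (_ : (fun _ => _) = (fun x => if b x then 1 else 0)); last first.
  by apply/funext => x; case: (b x).
exact: measurable_fun_ifT.
Qed.

Lemma measurable_funV (f : T -> R) :
  measurable_fun setT f -> measurable_fun setT (fun t => (f t)^-1).
Proof.
move=> mf; apply: (measurableT_comp (f := fun x : R => x^-1)) => //.
rewrite -(setUv [set (0 : R)]); apply/measurable_funU => //.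
  exact: measurableC.
split; first exact: measurable_fun_set1.
apply: open_continuous_measurable_fun;
  first exact/closed_openC/accessible_closed_set1/hausdorff_accessible.
by move=> x /[!inE]/= /eqP x0; exact: inv_continuous.
Qed.

(** Isolates the first of [n + 1] independent draws; all statements on
    product laws below are inductions through this identity. *)
Lemma integral_product_probS (P : probability T R) n (f : n.+1.-tuple T -> \bar R) :
  measurable_fun setT f -> (forall x, 0 <= f x)%E ->
  (\int[product_prob P n.+1]_x f x =
   \int[P]_x \int[product_prob P n]_y f (tuple_cons (x, y)))%E.
Proof.
move=> mf f0; rewrite /= /distribution ge0_integral_pushforward//= preimage_setT.
rewrite fubini_tonelli1//.
by apply: measurableT_comp => //; exact: measurable_tuple_cons.
Qed.

End integration_tools.

(** * The standard normal distribution *)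

Section normal_one_dim.
Context {R : realType}.
Notation mu := (@lebesgue_measure R).
Notation N01 := (normal_prob (0 : R) 1).
Notation phi := (normal_pdf (0 : R) 1).

(** The density is the Radon-Nikodym derivative of the law, almost
    everywhere. *)
Lemma integral_normal_prob (f : R -> \bar R) :
  measurable_fun setT f -> (forall x, 0 <= f x)%E ->
  (\int[N01]_x f x = \int[mu]_x (f x * (phi x)%:E))%E.
Proof.
move=> mf f0; have dom := normal_prob_dominates (0 : R) 1.
rewrite -(Radon_Nikodym_SigmaFinite.change_of_variables dom)//.
have ig := Radon_Nikodym_SigmaFinite.f_integrable dom.
have mg := measurable_int _ ig.
have mphi : measurable_fun setT (EFin \o phi).
  by measurable_auto.
apply: ge0_ae_eq_integral => //.
- exact: emeasurable_funM.
- exact: emeasurable_funM.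
- by move=> x _; rewrite mule_ge0//; exact: Radon_Nikodym_SigmaFinite.f_ge0.
- by move=> x _; rewrite mule_ge0// lee_fin normal_pdf_ge0.
apply: ae_eqe_mul2l; apply: integral_ae_eq => //.
by move=> A _ mA; rewrite -Radon_Nikodym_SigmaFinite.f_integral.
Qed.

Lemma lebesgue_measureD (h : R) (A : set R) : measurable A ->
  pushforward mu (fun x : measurableTypeR R => x + h : measurableTypeR R) A = mu A.
Proof.
move=> mA; have mD : @measurable_fun _ _ (measurableTypeR R) (measurableTypeR R) setT (fun x => x + h).
  by measurable_auto.
pose m : {measure set (measurableTypeR R) -> \bar R} :=
  measure_function_pushforward__canonical__measure_function_Measure mu mD.
apply/esym/(@lebesgue_measure_unique _ m) => //= _ [[a b]] _ <-.
rewrite /m /pushforward /=.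
rewrite [X in _ = mu X](_ : _ = `]a - h, b - h]%classic); last first.
  by apply/seteqP; split => x /=; rewrite !in_itv/= ltrBlDr lerBrDr.
rewrite !lebesgue_measure_itv/= !lte_fin ltrD2r.
by case: ifP => // _; rewrite -!EFinB; congr EFin; ring.
Qed.

Lemma integral_lebesgueD (h : R) (f : R -> \bar R) :
  measurable_fun setT f -> (forall x, 0 <= f x)%E ->
  (\int[mu]_x f (x + h)%R = \int[mu]_x f x)%E.
Proof.
move=> mf f0.
have mD : measurable_fun setT (fun x : measurableTypeR R => x + h : measurableTypeR R).
  by measurable_auto.
have -> : (\int[mu]_x f x = \int[pushforward mu (fun x : measurableTypeR R => (x + h)%R : measurableTypeR R)]_x f x)%E.
  by apply: eq_measure_integral => //= A mA _; exact/esym/lebesgue_measureD.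
by rewrite ge0_integral_pushforward.
Qed.

Lemma normal_pdf01E (x : R) :
  phi x = (Num.sqrt (pi *+ 2))^-1 * expR (- (x ^+ 2 / 2)).
Proof.
rewrite normal_pdfE ?oner_eq0// /normal_peak /normal_fun expr1n mul1r subr0.
by rewrite mulNr.
Qed.

(** One-dimensional Cameron-Martin formula: after a translation of the
    Lebesgue integral, the ratio of the densities at [x - h] and [x] is the
    exponential on the right. *)
Lemma normal_prob_shift (h : R) (f : R -> \bar R) :
  measurable_fun setT f -> (forall x, 0 <= f x)%E ->
  (\int[N01]_x f (x + h)%R =
   \int[N01]_x (f x * (expR (h * x - h ^+ 2 / 2))%:E))%E.
Proof.
move=> mf f0.
have mD : measurable_fun setT (fun x : R => x + h) by measurable_auto.
have mE : measurable_fun setT (fun x : R => expR (h * x - h ^+ 2 / 2)).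
  by measurable_auto.
have mphi : measurable_fun setT phi by exact: measurable_normal_pdf.
rewrite !integral_normal_prob//=; last 3 first.
- by apply: emeasurable_funM => //; by measurable_auto.
- by move=> x; rewrite mule_ge0// lee_fin expR_ge0.
- by apply: measurableT_comp mD.
rewrite -(integral_lebesgueD (- h)); last 2 first.
- apply: emeasurable_funM => //; last by measurable_auto.
  by apply: (measurableT_comp mf).
- by move=> x; rewrite mule_ge0// lee_fin normal_pdf_ge0.
apply: eq_integral => x _; rewrite subrK -muleA -EFinM; congr (_ * _%:E)%E.
rewrite !normal_pdf01E mulrCA -expRD; congr (_ * expR _); by field.
Qed.

(** The integrand times the standard density is [u^-1] times the density of
    standard deviation [u^-1]. *)
Lemma normal_prob_mgf (u : R) : 0 < u ->
  (\int[N01]_x (expR (- ((u ^+ 2 - 1) * (x ^+ 2 / 2))))%:E = (u^-1)%:E)%E.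
Proof.
move=> u0.
have mE : measurable_fun setT (fun x : R => expR (- ((u ^+ 2 - 1) * (x ^+ 2 / 2)))).
  by measurable_auto.
rewrite integral_normal_prob//; last by measurable_auto.
rewrite -[RHS]mule1 -(integral_normal_pdf 0 u^-1).
rewrite -ge0_integralZl; last 4 first.
- exact: measurableT.
- by measurable_auto.
- by move=> x _; rewrite lee_fin normal_pdf_ge0.
- by rewrite lee_fin invr_ge0 ltW.
apply: eq_integral => x _; rewrite -!EFinM; congr EFin.
rewrite normal_pdf01E normal_pdfE ?invr_eq0 ?gt_eqF//.
rewrite /normal_peak /normal_fun subr0 mulrCA -expRD.
rewrite -mulrnAr sqrtrM ?sqr_ge0// sqrtr_sqr ger0_norm ?invr_ge0 ?ltW//.
set s := Num.ExtraDef.sqrtr _; have -> : (u^-1 * s)^-1 = u * s^-1 by rewrite invfM invrK.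
rewrite -[X in u^-1 * X]mulrA mulKf ?gt_eqF//; congr (_ * expR _).
have /eqP u0' := gt_eqF u0.
by field; apply/negbT/gt_eqF.
Qed.

(** The Laplace transform of the square is known, and [1 + t <= expR t]
    compares its difference quotient at [0] with the second moment.  The
    exponent is negative for [u > 1] and positive for [u < 1], which gives a
    lower and an upper bound, both tending to [1] as [u] tends to [1]. *)
Lemma normal_prob_sqr : (\int[N01]_x (x ^+ 2)%:E = 1)%E.
Proof.
have E1 (u : R) : 0 < u -> (u ^+ 2 - 1) / 2 * (2 / (u * (u + 1))) = 1 - u^-1.
  by move=> u0; field; rewrite !gt_eqF//; lra.
have E2 (u : R) : 0 < u -> (1 - u ^+ 2) / 2 * (2 / (u * (u + 1))) = u^-1 - 1.
  by move=> u0; field; rewrite !gt_eqF//; lra.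
(* Value at [u = 1] of the bound common to both sides. *)
have E3 : 1 = 2 / (1 * (1 + 1)) :> R by field.
have mE u : measurable_fun setT (fun x : R => expR (- ((u ^+ 2 - 1) * (x ^+ 2 / 2)))).
  by measurable_auto.
have mS : measurable_fun setT (fun x : R => x ^+ 2) by measurable_auto.
have S0 x : (0 <= (x ^+ 2)%:E :> \bar R)%E by rewrite lee_fin sqr_ge0.
have I1 : (\int[N01]_x 1%:E = 1)%E.
  by rewrite integral_cst//= probability_setT mule1.
set I := (\int[N01]_x _)%E.
have I0 : (0 <= I)%E by apply: integral_ge0.
have Ilo u : 1 < u -> ((2 / (u * (u + 1)))%:E <= I)%E.
  move=> u1; have u0 : 0 < u by lra.
  have k0 : 0 < (u ^+ 2 - 1) / 2 by rewrite divr_gt0// subr_gt0 exprn_egt1.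
  have : (1 <= (u^-1)%:E + ((u ^+ 2 - 1) / 2)%:E * I)%E.
    rewrite -{1}I1 -normal_prob_mgf// -ge0_integralZl//; last 2 first.
    - by measurable_auto.
    - by rewrite lee_fin ltW.
    rewrite -ge0_integralD//; last 3 first.
    - by measurable_auto.
    - by move=> x _; rewrite mule_ge0// lee_fin ltW.
    - by measurable_auto.
    apply: ge0_le_integral => //.
    - by measurable_auto.
    - move=> x _; rewrite -EFinM -EFinD lee_fin.
      have := expR_ge1Dx (- ((u ^+ 2 - 1) * (x ^+ 2 / 2))).
      lra.
  case: (I) I0 => [r| |]//; last by move=> _ _; rewrite leey.
  rewrite -EFinM -EFinD !lee_fin => _ h.
  rewrite -(ler_pM2l k0); rewrite E1//; lra.
have Ihi u : 0 < u -> u < 1 -> (I <= (2 / (u * (u + 1)))%:E)%E.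
  move=> u0 u1; have k0 : 0 < (1 - u ^+ 2) / 2.
    by rewrite divr_gt0// subr_gt0 exprn_ilt1// ltW.
  have : (1 + ((1 - u ^+ 2) / 2)%:E * I <= (u^-1)%:E)%E.
    rewrite -{1}I1 -normal_prob_mgf// -ge0_integralZl//; last 2 first.
    - by measurable_auto.
    - by rewrite lee_fin ltW.
    rewrite -ge0_integralD//; last 2 first.
    - by move=> x _; rewrite mule_ge0// lee_fin ltW.
    - by measurable_auto.
    apply: ge0_le_integral => //.
    - by move=> x _; rewrite adde_ge0// mule_ge0// lee_fin ltW.
    - by measurable_auto.
    - by measurable_auto.
    - move=> x _; rewrite -EFinM -EFinD lee_fin.
      have := expR_ge1Dx (- ((u ^+ 2 - 1) * (x ^+ 2 / 2))).
      lra.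
  case: (I) I0 => [r| |]//; last first.
    by rewrite gt0_muley ?lte_fin.
  rewrite -EFinM -EFinD !lee_fin => _ h.
  rewrite -(ler_pM2l k0); rewrite E2//; lra.
have cv : (fun u : R => 2 / (u * (u + 1))) u @[u --> (1 : R)] --> (1 : R).
  rewrite [X in _ --> X]E3.
  apply: cvgM; first exact: cvg_cst.
  apply: cvgV; first by apply/eqP; lra.
  by apply: cvgM; [exact: cvg_id|apply: cvgD; [exact: cvg_id|exact: cvg_cst]].
have Ifin : I \is a fin_num.
  rewrite ge0_fin_numE//; apply: le_lt_trans (Ihi (2^-1) _ _) (ltry _); lra.
rewrite -(fineK Ifin); congr EFin; apply/eqP; rewrite eq_le; apply/andP; split.
- have cvl : (fun u : R => 2 / (u * (u + 1))) u @[u --> (1 : R)^'-] --> (1 : R).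
    exact: cvg_at_left_filter cv.
  apply: (cvgr_to_ge cvl).
  near=> u; rewrite -lee_fin fineK//.
  have u0 : 0 < u by near: u; apply: nbhs_left_gt; exact: ltr01.
  by apply: Ihi => //; near: u; exact: nbhs_left_lt.
- have cvl : (fun u : R => 2 / (u * (u + 1))) u @[u --> (1 : R)^'+] --> (1 : R).
    exact: cvg_at_right_filter cv.
  apply: (cvgr_to_le cvl).
  near=> u; rewrite -lee_fin fineK//.
  by apply: Ilo; near: u; exact: nbhs_right_gt.
Unshelve. all: by end_near. Qed.

Lemma normal_prob_abs : (\int[N01]_x `|x|%:E <= 1)%E.
Proof.
have mS : measurable_fun setT (fun x : R => x ^+ 2) by measurable_auto.
apply: (@le_trans _ _ (\int[N01]_x ((2^-1)%:E + (2^-1)%:E * (x ^+ 2)%:E))%E).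
  apply: ge0_le_integral => //.
  - by measurable_auto.
  - by measurable_auto.
  - move=> x _; rewrite -EFinM -EFinD lee_fin -real_normK ?num_real//.
    have := sqr_ge0 (`|x| - 1); rewrite sqrrB; lra.
rewrite ge0_integralD//; last 2 first.
- by move=> x _; rewrite -EFinM lee_fin mulr_ge0// sqr_ge0.
- by measurable_auto.
rewrite integral_cst//= probability_setT ge0_integralZl//; last 2 first.
- by measurable_auto.
- by move=> x _; rewrite lee_fin sqr_ge0.
by rewrite normal_prob_sqr !mule1 -EFinD lee_fin; lra.
Qed.

Lemma normal_prob_set1 (x : R) : N01 [set x] = 0%E.
Proof. by rewrite /normal_prob integral_set1. Qed.

End normal_one_dim.

(** * Elementary integrals and planar Gaussian sectors *)

Section calculus.
Context {R : realType}.
Notation mu := (@lebesgue_measure R).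
Notation N01 := (normal_prob (0 : R) 1).
Notation phi := (normal_pdf (0 : R) 1).

Lemma integral_x_gauss (a c : R) : 0 <= a -> 0 < c ->
  (\int[mu]_(x in `[a, +oo[) (x * expR (- (c * (x ^+ 2 / 2))))%:E =
   (expR (- (c * (a ^+ 2 / 2))) / c)%:E)%E.
Proof.
move=> a0 c0; pose F (x : R) : R := - (expR (- (c * (x ^+ 2 / 2))) / c).
have dF (x : R) : is_derive x 1 F (x * expR (- (c * (x ^+ 2 / 2)))).
  rewrite /F; apply: is_derive_eq.
  rewrite /GRing.scale/=; field.
  by rewrite gt_eqF.
have cf : continuous (fun x : R => x * expR (- (c * (x ^+ 2 / 2)))).
  move=> x; apply: cvgM; first exact: cvg_id.
  apply: continuous_comp; last exact: continuous_expR.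
  apply: cvgN; apply: cvgM; first exact: cvg_cst.
  apply: cvgM; last exact: cvg_cst.
  exact: exprn_continuous.
have cF : continuous F.
  by move=> x; apply: differentiable_continuous; apply/derivable1_diffP; exact: ex_derive.
rewrite (@ge0_continuous_FTC2y _ _ F a 0)//.
- by rewrite add0e -EFinN /F opprK.
- by move=> x ax; rewrite mulr_ge0 ?expR_ge0// (le_trans a0).
- exact: continuous_subspaceT.
- rewrite /F -[X in _ --> X]oppr0 -[X in _ --> - X](mul0r c^-1).
  apply: cvgN; apply: cvgM; last exact: cvg_cst.
  apply: (cvg_comp (fun x : R => c * (x ^+ 2 / 2)) (fun x => expR (- x))).
    apply: gt0_cvgMry => //; apply: gt0_cvgMly; last exact: cvgr_expr2.
    by rewrite invr_gt0.
  exact: cvgr_expR.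
- exact/cvg_at_right_filter/cF.
- by move=> x _; rewrite derive1E; exact: derive_val.
Qed.

Lemma integral_invX k :
  (\int[mu]_(x in `[1%R, +oo[) ((x^-1) ^+ k.+2)%:E = (k.+1%:R^-1)%:E)%E.
Proof.
pose F (x : R) : R := - (x^-1 ^+ k.+1 / k.+1%:R).
have dF (x : R) : 0 < x -> is_derive x 1 F ((x^-1) ^+ k.+2).
  move=> x0; have xn0 : x != 0 by rewrite gt_eqF.
  have dV : is_derive x 1 (fun y : R => y^-1) (- x ^- 2 *: 1).
    apply: DeriveDef; first exact: (@derivableV _ _ id).
    by rewrite (@deriveV _ _ id)// derive_id.
  have dX : is_derive x 1 (fun y : R => y^-1 ^+ k.+1)
      ((k.+1%:R * x^-1 ^+ k) *: (- x ^- 2 *: 1)).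
    rewrite (_ : (fun _ => _) = (fun y : R => y^-1) ^+ k.+1).
      exact: is_deriveX.
    by apply/funext => y; rewrite exprfctE.
  rewrite /F; apply: is_derive_eq.
  rewrite !scaler0 add0r /GRing.scale/= mulr1 (exprS _ k.+1) (exprS _ k) expr2.
  have kn : k.+1%:R != 0 :> R by rewrite pnatr_eq0.
  by move: (k.+1%:R) kn (x^-1 ^+ k) => N kn X; field; rewrite ?kn ?xn0.
have cV (x : R) : 0 < x -> {for x, continuous (fun x : R => x^-1)}.
  by move=> x0; apply: cvgV; [rewrite gt_eqF|exact: cvg_id].
rewrite (@ge0_continuous_FTC2y _ _ F 1 0)//.
- by rewrite add0e -EFinN /F opprK invr1 expr1n mul1r.
- by move=> x x1; rewrite exprn_ge0// invr_ge0 (le_trans _ x1).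
- apply: continuous_in_subspaceT => x /[!inE]/= /[!in_itv]/= /andP[x1 _].
  apply: (@continuous_comp _ _ _ (fun x : R => x^-1) (fun x => x ^+ k.+2)).
    by apply: cV; rewrite (lt_le_trans _ x1).
  exact: exprn_continuous.
- rewrite /F -[X in _ --> X]oppr0 -[X in _ --> - X](mul0r k.+1%:R^-1).
  apply: cvgN; apply: cvgM; last exact: cvg_cst.
  rewrite -[X in _ --> X](expr0n R k.+1).
  apply: (cvg_comp (fun x : R => x^-1) (fun x => x ^+ k.+1)); last first.
    exact: exprn_continuous.
  apply/gtr0_cvgV0; last exact: cvg_id.
  by near=> x; near: x; exact: nbhs_pinfty_gt.
- by move=> x x1; have := dF x (lt_trans ltr01 x1) => ?; exact: ex_derive.
- apply/cvg_at_right_filter; apply: differentiable_continuous.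
  apply/derivable1_diffP; have := dF 1 ltr01 => ?; exact: ex_derive.
- move=> x; rewrite in_itv/= andbT => x1; rewrite derive1E.
  by have := dF x (lt_trans ltr01 x1) => ?; exact: derive_val.
Unshelve. all: by end_near. Qed.

Lemma integral_oneDsqrV (T : R) :
  (\int[mu]_(s in `[T, +oo[) ((1 + s ^+ 2)^-1)%:E = (pi / 2 - atan T)%:E)%E.
Proof.
rewrite (ge0_continuous_FTC2y _ _ (@cvgy_atan R))/=.
- by rewrite EFinB.
- by move=> x _; rewrite invr_ge0 addr_ge0// sqr_ge0.
- by apply: continuous_subspaceT; exact: continuous_oneDsqrV.
- move=> x _; exact: ex_derive.
- by apply: cvg_at_right_filter; exact: continuous_atan.
- by move=> x _; rewrite derive1E; exact: derive_val.
Qed.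

Lemma normal_pdf_even (x : R) : phi (- x) = phi x.
Proof. by rewrite !normal_pdf01E sqrrN. Qed.

(** The substitution [y = - x s] writes the tail as an integral over
    slopes [s >= T], the variable in which the sector becomes a product. *)
Lemma normal_tail_scale (T x : R) : 0 < x ->
  N01 [set y | y < - (T * x)] =
  (\int[mu]_(s in `[T, +oo[) (phi (x * s) * x)%:E)%E.
Proof.
move=> x0; rewrite /normal_prob.
have cphi : continuous phi by apply: continuous_normal_pdf; exact: oner_neq0.
rewrite (_ : [set y | y < - (T * x)] = `]-oo, (- (T * x))%R[%classic); last first.
  by apply/seteqP; split => y /=; rewrite in_itv.
rewrite integral_itv_bndo_bndc; last first.
  by apply: measurable_funTS; measurable_auto.
rewrite ge0_integration_by_substitutionNy; last 2 first.
- exact: continuous_subspaceT.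
- by move=> y _; exact: normal_pdf_ge0.
rewrite [T * x]mulrC.
have dF (s : R) : is_derive s 1 ( *%R x) x.
  by apply: is_derive_eq; rewrite /GRing.scale/= mulr1.
have F' : derive1 ( *%R x) = cst x.
  by apply/funext => s; rewrite derive1E; exact: derive_val.
rewrite (@increasing_ge0_integration_by_substitutiony _ ( *%R x)); last first.
- by move=> y _ /=; exact: normal_pdf_ge0.
- apply: continuous_subspaceT => y; apply: continuous_comp; last exact: cphi.
  exact: oppr_continuous.
- by apply: gt0_cvgMry => //; exact: cvg_id.
- split; first by move=> s _; exact: ex_derive.
  by apply: cvg_at_right_filter; exact: mulrl_continuous.
- by rewrite F'; exact: is_cvg_cst.
- by rewrite F'; exact: is_cvg_cst.
- by rewrite F' => s _; exact: cst_continuous.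
- by move=> s t _ _ st; rewrite ltr_pM2l.
apply: eq_integral => s _; congr EFin.
by rewrite fctE /= F' normal_pdf_even.
Qed.

(** The sector is swept by the half-lines [y = - s x] with slopes [s >= T].
    Integrating over [x > 0] first leaves [1 / (2 pi (1 + s ^+ 2))], a Cauchy
    density in [s].  This is polar coordinates in disguise. *)
Lemma normal_sector (T : R) : 0 <= T ->
  (\int[N01]_x \int[N01]_y ((0 < x) && (y < - (T * x))%R)%:R%:E =
   ((pi / 2 - atan T) / (2 * pi))%:E)%E.
Proof.
move=> T0; pose H (z : R * R) : \bar R :=
  (((0 < z.1) && (T <= z.2))%R%:R%:E * (phi (z.1 * z.2) * z.1 * phi z.1)%:E)%E.
have H0 z : (0 <= H z)%E.
  rewrite /H; case: (ltP 0 z.1) => z0/=; last by rewrite mul0e.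
  by rewrite mule_ge0// lee_fin// !mulr_ge0 ?normal_pdf_ge0// ltW.
have mH : measurable_fun setT H.
  apply: emeasurable_funM; apply/measurable_EFinP.
    apply: measurable_boolR; apply: measurable_and.
      exact: measurable_fun_ltr.
    exact: measurable_fun_ler.
  apply: measurable_funM; last by apply: (measurableT_comp (measurable_normal_pdf _ _)).
  apply: measurable_funM => //.
  apply: (measurableT_comp (measurable_normal_pdf _ _)).
  exact: measurable_funM.
pose g (x : R) : \bar R := (\int[N01]_y ((0 < x) && (y < - (T * x))%R)%:R%:E)%E.
have mg : measurable_fun setT g.
  pose G (z : R * R) : \bar R := ((0 < z.1) && (z.2 < - (T * z.1))%R)%:R%:E.
  apply: (@measurable_fun_fubini_tonelli_F _ _ _ _ _ N01 G) => //.
    apply/measurable_EFinP/measurable_boolR/measurable_and.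
      exact: measurable_fun_ltr.
    apply: measurable_fun_ltr => //; apply: measurable_funN.
    exact: measurable_funM.
  by move=> z; rewrite lee_fin ler0n.
have g0 x : (0 <= g x)%E by apply: integral_ge0.
rewrite integral_normal_prob//.
transitivity (\int[mu]_x \int[mu]_s H (x, s))%E.
  apply: eq_integral => x _; rewrite /g /H/=.
  have [x0|x0] := ltP 0 x; last first.
    by rewrite !integral0_eq ?mul0e// => s _; rewrite mul0e.
  rewrite integral_bool/=; last first.
    by rewrite (_ : [set y | y < - (T * x)] = `]-oo, (- (T * x))%R[%classic).
  rewrite normal_tail_scale//.
  rewrite muleC -ge0_integralZl//; last 3 first.
  - by apply: measurable_funTS; measurable_auto.
  - by move=> s _; rewrite lee_fin mulr_ge0 ?normal_pdf_ge0// ltW.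
  - by rewrite lee_fin normal_pdf_ge0.
  rewrite (integral_boolM (mu : {measure set (measurableTypeR R) -> \bar R})).
  rewrite (_ : [set s | T <= s] = `[T, +oo[%classic); last first.
    by apply/seteqP; split => s /=; rewrite in_itv/= andbT.
  by apply: eq_integral => s _; rewrite -EFinM; congr EFin; rewrite mulrC.
have -> := @fubini_tonelli _ _ (measurableTypeR R) (measurableTypeR R) R mu mu H mH H0.
transitivity (\int[mu]_(s in `[T, +oo[) (((2 * pi)^-1)%:E * ((1 + s ^+ 2)^-1)%:E))%E.
  rewrite (_ : `[T, +oo[%classic = [set s | T <= s]); last first.
    by apply/seteqP; split => s /=; rewrite in_itv/= andbT.
  rewrite -(integral_boolM (mu : {measure set (measurableTypeR R) -> \bar R})).
  apply: eq_integral => s _; rewrite /H/=.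
  have [Ts|Ts] := leP T s; last first.
    by rewrite mul0e integral0_eq// => x _; rewrite andbF mul0e.
  rewrite mul1e.
  transitivity (\int[mu]_x ((0 < x :> R)%R%:R%:E * (((2 * pi)^-1)%:E *
     (x * expR (- ((1 + s ^+ 2) * (x ^+ 2 / 2))))%:E)))%E.
    apply: eq_integral => x _; rewrite andbT; congr (_ * _)%E.
    rewrite -EFinM; congr EFin; rewrite !normal_pdf01E.
    rewrite (_ : (2 * pi)^-1 = (Num.sqrt (pi *+ 2))^-1 * (Num.sqrt (pi *+ 2))^-1); last first.
      rewrite -invfM -expr2 sqr_sqrtr ?mulr_natl// mulrn_wge0// pi_ge0//.
    rewrite (_ : - ((1 + s ^+ 2) * (x ^+ 2 / 2)) = - ((x * s) ^+ 2 / 2) + - (x ^+ 2 / 2));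
      last by field.
    by rewrite expRD; ring.
  rewrite (integral_boolM (mu : {measure set (measurableTypeR R) -> \bar R})).
  rewrite (_ : [set x | 0 < x] = `]0%R, +oo[%classic); last first.
    by apply/seteqP; split => x /=; rewrite in_itv/= andbT.
  rewrite integral_itv_obnd_cbnd; last by apply: measurable_funTS; measurable_auto.
  have s0 : 0 < 1 + s ^+ 2 by rewrite ltr_pwDl// sqr_ge0.
  rewrite ge0_integralZl//; last 3 first.
  - by apply: measurable_funTS; measurable_auto.
  - by move=> x /=; rewrite in_itv/= andbT => x0; rewrite lee_fin mulr_ge0// expR_ge0.
  - by rewrite lee_fin invr_ge0 mulr_ge0// pi_ge0.
  rewrite integral_x_gauss//; congr (_ * _%:E)%E.
  by rewrite expr0n/= mul0r mulr0 oppr0 expR0 div1r.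
rewrite ge0_integralZl//; last 3 first.
- apply: measurable_funTS; apply/measurable_EFinP; apply: continuous_measurable_fun.
  exact: continuous_oneDsqrV.
- by move=> x _; rewrite lee_fin invr_ge0 addr_ge0// sqr_ge0.
- by rewrite lee_fin invr_ge0 mulr_ge0// pi_ge0.
by rewrite integral_oneDsqrV -EFinM mulrC.
Qed.

End calculus.

(** * Inequalities for the inverse trigonometric functions *)

Section trigonometry.
Context {R : realType}.

(** The angle [pi / 2 - atan b] has cosine [b / sqrt (1 + b^2) <= b], and the
    cosine decreases on [0, pi].  When [b > 1] the left-hand side is the
    default value [0]. *)
Lemma acos_le_atan (b : R) : 0 <= b -> acos b <= pi / 2 - atan b.
Proof.
move=> b0; have [b1|b1] := leP b 1; last first.
  by rewrite acos_gt1// subr_ge0 ltW// atan_ltpi2.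
have a0 : 0 <= atan b by rewrite -(@atan0 R) le_atan.
have bI : -1 <= b <= 1 by rewrite b1 (le_trans _ b0)// oppr_le0.
rewrite leNgt; apply/negP => lt; have pi2 : pi / 2 <= pi :> R.
  by rewrite ler_pdivrMr// ler_peMr ?pi_ge0// ler1n.
have : cos (acos b) < cos (pi / 2 - atan b).
  rewrite ltr_cos// in_itv/= ?acos_ge0 ?acos_lepi//.
  rewrite subr_ge0 (ltW (atan_ltpi2 _))/= lerBlDr.
  by rewrite (le_trans pi2)// lerDl.
rewrite acosK ?in_itv//= -cosN opprB cosBpihalf.
have cn0 : cos (atan b) != 0.
  by rewrite gt_eqF// cos_gt0_pihalf// atan_gtNpi2 atan_ltpi2.
rewrite -[sin _](divfK cn0) -/(tan _) atanK cos_atan ltNge ler_piMr//.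
by rewrite invf_le1 ?sqrtr_gt0 ?ltr_pwDl ?sqr_ge0// -[leLHS]sqrtr1 ler_wsqrtr// lerDl sqr_ge0.
Qed.

(** A concave function lies below its tangents; here directly from the mean
    value theorem, the derivative of [atan] being decreasing on [0, +oo[. *)
Lemma atan_tangent (t0 t : R) : 0 <= t0 -> 0 <= t ->
  atan t <= atan t0 + (t - t0) / (1 + t0 ^+ 2).
Proof.
move=> t00 t_ge0.
have D (x : R) : 0 < 1 + x ^+ 2 by rewrite ltr_pwDl// sqr_ge0.
have mvt (x y : R) : x < y -> exists2 c, x < c < y &
    atan y - atan x = (1 + c ^+ 2)^-1 * (y - x).
  move=> xy; have cA : {within `[x, y], continuous (@atan R)}.
    by apply: continuous_subspaceT => z; exact: continuous_atan.
  have [c cxy ->] := MVT xy (fun z _ => is_derive1_atan z) cA.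
  by exists c => //; move: cxy; rewrite in_itv.
case: (ltgtP t t0) => [tt|tt|->]; last by rewrite subrr mul0r addr0.
- have [c /andP[tc ct] e] := mvt _ _ tt.
  rewrite -lerBlDl -opprB e -[X in _ <= X / _]opprB mulNr lerN2 mulrC.
  rewrite ler_pM2r ?subr_gt0// lef_pV2 ?posrE// lerD2l.
  by rewrite lerXn2r ?nnegrE// ltW// (le_lt_trans t_ge0).
- have [c /andP[tc ct] e] := mvt _ _ tt.
  rewrite -lerBlDl e mulrC ler_pM2l ?subr_gt0// lef_pV2 ?posrE// lerD2l.
  by rewrite lerXn2r ?nnegrE// ltW// (le_lt_trans t00).
Qed.

End trigonometry.

(** * Random column vectors and their inner product *)

Section measurable_vectors.
Context {R : realType}.

(** Measurability is carried by tuples and linear algebra by columns, so both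
    vector-valued maps and functions of a vector get a predicate of their own;
    [measurable_on_cV_comp] composes them. *)
Definition measurable_cV d (T : measurableType d) k (G : T -> 'cV[R]_k) :=
  forall i, measurable_fun setT (fun t => G t i 0).

Definition measurable_on_cV k (f : 'cV[R]_k -> \bar R) :=
  measurable_fun setT (fun x => f (vec_of_tuple x)).

Lemma tuple_of_vecK k : cancel (@tuple_of_vec R k) vec_of_tuple.
Proof. by move=> v; apply/colP => i; rewrite !mxE tnth_mktuple. Qed.

Lemma measurable_tuple_of_vec d (T : measurableType d) k (G : T -> 'cV[R]_k) :
  measurable_cV G -> measurable_fun setT (fun t => tuple_of_vec (G t)).
Proof.
move=> mG; apply/measurable_fun_tnthP => i.
rewrite (_ : _ \o _ = fun t => G t i 0)//.
by apply/funext => t /=; rewrite tnth_mktuple.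
Qed.

Lemma measurable_on_cV_comp d (T : measurableType d) k (f : 'cV[R]_k -> \bar R)
    (G : T -> 'cV[R]_k) :
  measurable_on_cV f -> measurable_cV G -> measurable_fun setT (fun t => f (G t)).
Proof.
move=> mf mG.
rewrite (_ : (fun _ => _) = (fun x => f (vec_of_tuple x)) \o (fun t => tuple_of_vec (G t))).
  by apply: measurableT_comp => //; exact: measurable_tuple_of_vec.
by apply/funext => t /=; rewrite tuple_of_vecK.
Qed.

Lemma measurable_cV_tuple d (T : measurableType d) k (g : T -> k.-tuple R) :
  measurable_fun setT g -> measurable_cV (fun t => vec_of_tuple (g t)).
Proof.
move=> mg i; under eq_fun do rewrite mxE.
by apply: (measurableT_comp (measurable_tnth i)).
Qed.

Lemma measurable_cV_cst d (T : measurableType d) k (v : 'cV[R]_k) : measurable_cV (fun _ : T => v).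
Proof. by move=> i; exact: measurable_cst. Qed.

Lemma measurable_cVD d (T : measurableType d) k (G H : T -> 'cV[R]_k) :
  measurable_cV G -> measurable_cV H -> measurable_cV (fun t => G t + H t).
Proof.
by move=> mG mH i; under eq_fun do rewrite mxE; exact: measurable_funD.
Qed.

Lemma measurable_cVZ d (T : measurableType d) k (a : R) (G : T -> 'cV[R]_k) :
  measurable_cV G -> measurable_cV (fun t => a *: G t).
Proof.
by move=> mG i; under eq_fun do rewrite mxE; exact: measurable_funM.
Qed.

Lemma measurable_cV_mulmx d (T : measurableType d) k l (A : 'M[R]_(l, k)) (G : T -> 'cV[R]_k) :
  measurable_cV G -> measurable_cV (fun t => A *m G t).
Proof.
move=> mG i; under eq_fun do rewrite mxE.
by apply: measurable_sum => j; exact: measurable_funM.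
Qed.

Lemma measurable_cV_col_mx d (T : measurableType d) k l (G : T -> 'cV[R]_k) (H : T -> 'cV[R]_l) :
  measurable_cV G -> measurable_cV H -> measurable_cV (fun t => col_mx (G t) (H t)).
Proof.
move=> mG mH i; under eq_fun do rewrite mxE.
by case: (fintype.split i) => j; [exact: mG|exact: mH].
Qed.

Lemma measurable_cV_scalar d (T : measurableType d) (g : T -> R) :
  measurable_fun setT g -> measurable_cV (fun t => (g t)%:M : 'cV_1).
Proof. by move=> mg i; under eq_fun do rewrite mxE ord1 eqxx mulr1n. Qed.

Lemma measurable_cV_usubmx d (T : measurableType d) k l (G : T -> 'cV[R]_(k + l)) :
  measurable_cV G -> measurable_cV (fun t => usubmx (G t)).
Proof. by move=> mG i; under eq_fun do rewrite mxE; exact: mG. Qed.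

Lemma measurable_cV_dsubmx d (T : measurableType d) k l (G : T -> 'cV[R]_(k + l)) :
  measurable_cV G -> measurable_cV (fun t => dsubmx (G t)).
Proof. by move=> mG i; under eq_fun do rewrite mxE; exact: mG. Qed.

Lemma measurable_dotv d (T : measurableType d) k (G H : T -> 'cV[R]_k) :
  measurable_cV G -> measurable_cV H -> measurable_fun setT (fun t => dotv (G t) (H t)).
Proof.
by move=> mG mH; apply: measurable_sum => i; exact: measurable_funM.
Qed.

End measurable_vectors.

Section dotv_theory.
Context {R : realType}.

Lemma dotvE k (u v : 'cV[R]_k) : dotv u v = (u^T *m v) 0 0.
Proof. by rewrite mxE; apply: eq_bigr => i _; rewrite mxE. Qed.

Lemma dotvC k (u v : 'cV[R]_k) : dotv u v = dotv v u.
Proof. by apply: eq_bigr => i _; rewrite mulrC. Qed.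

Lemma dotvDl k (u v w : 'cV[R]_k) : dotv (u + v) w = dotv u w + dotv v w.
Proof. by rewrite /dotv -big_split; apply: eq_bigr => i _; rewrite mxE mulrDl. Qed.

Lemma dotvDr k (u v w : 'cV[R]_k) : dotv w (u + v) = dotv w u + dotv w v.
Proof. by rewrite dotvC dotvDl !(dotvC w). Qed.

Lemma dotvZl k a (u v : 'cV[R]_k) : dotv (a *: u) v = a * dotv u v.
Proof. by rewrite /dotv mulr_sumr; apply: eq_bigr => i _; rewrite mxE mulrA. Qed.

Lemma dotvZr k a (u v : 'cV[R]_k) : dotv u (a *: v) = a * dotv u v.
Proof. by rewrite dotvC dotvZl dotvC. Qed.

Lemma dotvNl k (u v : 'cV[R]_k) : dotv (- u) v = - dotv u v.
Proof. by rewrite -scaleN1r dotvZl mulN1r. Qed.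

Lemma dotvNr k (u v : 'cV[R]_k) : dotv u (- v) = - dotv u v.
Proof. by rewrite dotvC dotvNl dotvC. Qed.

Lemma dot0v k (v : 'cV[R]_k) : dotv 0 v = 0.
Proof. by rewrite -(scale0r 0) dotvZl mul0r. Qed.

Lemma dotv_mulmxl k l (A : 'M[R]_(k, l)) (u : 'cV[R]_l) (v : 'cV[R]_k) :
  dotv (A *m u) v = dotv u (A^T *m v).
Proof. by rewrite !dotvE trmx_mul mulmxA. Qed.

Lemma dotv_col_mx k l (a c : 'cV[R]_k) (b e : 'cV[R]_l) :
  dotv (col_mx a b) (col_mx c e) = dotv a c + dotv b e.
Proof. by rewrite !dotvE tr_col_mx mul_row_col mxE. Qed.

Lemma dotv_scalar (x y : R) : dotv x%:M y%:M = x * y.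
Proof. by rewrite /dotv big_ord1 !mxE eqxx !mulr1n. Qed.

Lemma dotv_ge0 k (v : 'cV[R]_k) : 0 <= dotv v v.
Proof. by apply: sumr_ge0 => i _; rewrite -expr2 sqr_ge0. Qed.

Lemma dotv_eq0 k (v : 'cV[R]_k) : (dotv v v == 0) = (v == 0).
Proof.
apply/eqP/eqP => [|->]; last by rewrite dot0v.
move=> /eqP; rewrite psumr_eq0; last by move=> i _; rewrite -expr2 sqr_ge0.
move=> /allP h; apply/colP => i; rewrite mxE.
by have := h i; rewrite mem_index_enum -expr2 sqrf_eq0 => /(_ isT)/eqP.
Qed.

Lemma dotv_orth k (O : 'M[R]_k) (u v : 'cV[R]_k) : O^T *m O = 1%:M ->
  dotv (O *m u) (O *m v) = dotv u v.
Proof. by move=> OO; rewrite dotv_mulmxl mulmxA OO mul1mx. Qed.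

Lemma cV_split k (v : 'cV[R]_(1 + k)) :
  v = col_mx (v (lshift k 0) 0)%:M (dsubmx v).
Proof.
rewrite -[LHS]vsubmxK; congr col_mx; apply/colP => i.
by rewrite !mxE !ord1 eqxx mulr1n.
Qed.

(** The reflection exchanging [v] and [|v| e1], two vectors of the same norm,
    is [1 - 2 u u^T / (u . u)] with [u = v - |v| e1]. *)
Lemma householder k (v : 'cV[R]_(1 + k)) : exists2 O : 'M[R]_(1 + k),
  O^T *m O = 1%:M & O *m v = col_mx (Num.sqrt (dotv v v))%:M 0.
Proof.
set t := col_mx _ _; have tt : dotv t t = dotv v v.
  by rewrite dotv_col_mx dotv_scalar dot0v addr0 -expr2 sqr_sqrtr// dotv_ge0.
have [->|vt] := eqVneq v t; first by exists 1%:M; rewrite ?mul1mx ?trmx1 ?mulmx1.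
pose u := v - t; have uu0 : dotv u u != 0 by rewrite dotv_eq0 subr_eq0.
have uuE : dotv u u = 2 * dotv u v.
  by rewrite /u !(dotvDl, dotvDr, dotvNl, dotvNr) tt (dotvC t v); ring.
have scal (a b : 'cV[R]_(1 + k)) : a^T *m b = (dotv a b)%:M.
  by apply/matrixP => i j; rewrite !ord1 dotvE [RHS]mxE eqxx mulr1n.
have [M [MT MM Mv]] : exists M : 'M[R]_(1 + k),
    [/\ M^T = M, M *m M = dotv u u *: M & M *m v = dotv u v *: u].
  exists (u *m u^T); split; first by rewrite trmx_mul trmxK.
    by rewrite mulmxA -(mulmxA u) scal mul_mx_scalar -scalemxAl.
  by rewrite -mulmxA scal mul_mx_scalar.
pose c := 2 / dotv u u.
exists (1%:M - c *: M).
  have -> : (1%:M - c *: M)^T = 1%:M - c *: M.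
    apply/matrixP => i j; have MTij : M j i = M i j by rewrite -[in LHS]MT mxE.
    by rewrite !mxE MTij eq_sym.
  rewrite mulmxBr mulmx1 mulmxBl mul1mx -scalemxAl -scalemxAr MM !scalerA.
  rewrite (_ : c * c * dotv u u = c + c); last by rewrite /c; field.
  by rewrite scalerDl opprB addrK subrK.
rewrite mulmxBl mul1mx -scalemxAl Mv scalerA /c uuE.
have uv0 : dotv u v != 0 by apply: contra_neq uu0 => uv; rewrite uuE uv mulr0.
by rewrite (_ : _ * _ = 1) ?scale1r /u ?subKr//; field.
Qed.

End dotv_theory.

(** * Invariances of the standard Gaussian vector *)

Section gaussian_vector.
Context {R : realType}.
Notation N01 := (normal_prob (0 : R) 1).
Notation gauss k := (product_prob (normal_prob (0 : R) 1) k).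
Local Open Scope ereal_scope.

Definition gauss_int k (f : 'cV[R]_k -> \bar R) : \bar R :=
  \int[gauss k]_z f (vec_of_tuple z).

Lemma eq_gauss_int k (f g : 'cV[R]_k -> \bar R) : f =1 g -> gauss_int f = gauss_int g.
Proof. by move=> fg; apply: eq_integral => z _; exact: fg. Qed.

Lemma gauss_int_ge0 k (f : 'cV[R]_k -> \bar R) : (forall v, 0 <= f v) -> 0 <= gauss_int f.
Proof. by move=> f0; apply: integral_ge0 => z _. Qed.

Lemma gauss_int_cst k (c : \bar R) : gauss_int (fun _ : 'cV[R]_k => c) = c.
Proof.
transitivity (c * gauss k setT); first exact: integral_cst.
by rewrite probability_setT mule1.
Qed.

Lemma le_gauss_int k (f g : 'cV[R]_k -> \bar R) : measurable_on_cV f -> measurable_on_cV g ->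
  (forall v, 0 <= f v) -> (forall v, f v <= g v) -> gauss_int f <= gauss_int g.
Proof.
by move=> mf mg f0 fg; apply: ge0_le_integral => // z _; exact: le_trans (fg _).
Qed.

Lemma gauss_intD k (f g : 'cV[R]_k -> \bar R) : measurable_on_cV f -> measurable_on_cV g ->
  (forall v, 0 <= f v) -> (forall v, 0 <= g v) ->
  gauss_int (fun v => f v + g v) = gauss_int f + gauss_int g.
Proof. by move=> mf mg f0 g0; apply: ge0_integralD. Qed.

Lemma gauss_intZl k (c : \bar R) (f : 'cV[R]_k -> \bar R) : measurable_on_cV f ->
  (forall v, 0 <= f v) -> 0 <= c -> gauss_int (fun v => c * f v) = c * gauss_int f.
Proof. by move=> mf f0 c0; apply: ge0_integralZl. Qed.

Lemma gauss_intZr k (c : \bar R) (f : 'cV[R]_k -> \bar R) : measurable_on_cV f ->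
  (forall v, 0 <= f v) -> 0 <= c -> gauss_int (fun v => f v * c) = gauss_int f * c.
Proof. by move=> mf f0 c0; apply: ge0_integralZr. Qed.

Lemma measurable_gauss_int d (T : measurableType d) k (f : T -> 'cV[R]_k -> \bar R) :
  measurable_fun setT (fun z : T * k.-tuple R => f z.1 (vec_of_tuple z.2)) ->
  (forall t v, 0 <= f t v) ->
  measurable_fun setT (fun t => gauss_int (f t)).
Proof.
move=> mf f0.
exact: (@measurable_fun_fubini_tonelli_F _ _ _ _ _ (gauss k)
  (fun z : T * k.-tuple R => f z.1 (vec_of_tuple z.2))).
Qed.

Lemma gauss_int_swap k l (f : 'cV[R]_k -> 'cV[R]_l -> \bar R) :
  measurable_fun setT (fun z : k.-tuple R * l.-tuple R =>
    f (vec_of_tuple z.1) (vec_of_tuple z.2)) ->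
  (forall v w, 0 <= f v w) ->
  gauss_int (fun v => gauss_int (f v)) = gauss_int (fun w => gauss_int (f ^~ w)).
Proof.
move=> mf f0; apply: (@fubini_tonelli _ _ _ _ R (gauss k) (gauss l)
  (fun z : k.-tuple R * l.-tuple R => f (vec_of_tuple z.1) (vec_of_tuple z.2)) mf).
by move=> z; exact: f0.
Qed.

Lemma gauss_int0 (f : 'cV[R]_0 -> \bar R) : gauss_int f = f 0%R.
Proof.
rewrite (_ : f = cst (f 0%R)); first by rewrite gauss_int_cst.
by apply/funext => v /=; rewrite [v]flatmx0.
Qed.

Lemma vec_of_tuple_cons k (x : R) (z : k.-tuple R) :
  vec_of_tuple (tuple_cons (x, z)) = col_mx x%:M (vec_of_tuple z) :> 'cV_(1 + k).
Proof.
apply/colP => i; rewrite !mxE; case: fintype.splitP => j ij.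
  rewrite mxE !ord1 eqxx mulr1n (_ : i = ord0)//; apply/val_inj => /=.
  by rewrite ij ord1.
rewrite mxE (_ : i = lift ord0 j) ?tnthS//; apply/val_inj => /=.
by rewrite ij.
Qed.

Lemma gauss_intS k (f : 'cV[R]_(1 + k) -> \bar R) :
  measurable_on_cV f -> (forall v, 0 <= f v) ->
  gauss_int f = \int[N01]_x gauss_int (fun v => f (col_mx x%:M v)).
Proof.
move=> mf f0; rewrite /gauss_int integral_product_probS; last 2 first.
- exact: mf.
- by move=> z; exact: f0.
apply: eq_integral => x _; apply: eq_integral => z _.
by rewrite vec_of_tuple_cons.
Qed.

(** Density of the standard Gaussian law translated by [h] with respect to
    the centred one. *)
Definition shift_density k (h v : 'cV[R]_k) : R := expR (dotv h v - dotv h h / 2).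

Lemma shift_density_ge0 k (h v : 'cV[R]_k) : (0 <= shift_density h v)%R.
Proof. exact: expR_ge0. Qed.

Lemma measurable_shift_density d (T : measurableType d) k (G H : T -> 'cV[R]_k) :
  measurable_cV G -> measurable_cV H -> measurable_fun setT (fun t => shift_density (G t) (H t)).
Proof.
move=> mG mH; apply: (measurableT_comp (@measurable_expR _)).
apply: measurable_funB; first exact: measurable_dotv.
by apply: measurable_funM => //; exact: measurable_dotv.
Qed.

Lemma measurable_cV_id k : measurable_cV (@vec_of_tuple R k).
Proof. by apply: (measurable_cV_tuple (g := id)). Qed.

Lemma shift_density_col_mx k (a x : R) (b v : 'cV[R]_k) :
  (shift_density (col_mx a%:M b) (col_mx x%:M v) =
   shift_density b v * expR (a * x - a ^+ 2 / 2))%R.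
Proof.
rewrite /shift_density !dotv_col_mx !dotv_scalar -expRD; congr expR.
by field.
Qed.

Lemma scalar_mxD k (x y : R) : ((x + y)%:M = x%:M + y%:M :> 'M[R]_k)%R.
Proof. by apply/matrixP => i j; rewrite !mxE mulrnDl. Qed.

(** Cameron-Martin formula in dimension [k], one coordinate at a time. *)
Lemma gauss_int_shift k (h : 'cV[R]_k) (f : 'cV[R]_k -> \bar R) :
  measurable_on_cV f -> (forall v, 0 <= f v) ->
  gauss_int (fun v => f (v + h)%R) = gauss_int (fun v => f v * (shift_density h v)%:E).
Proof.
elim: k h f => [h f mf f0|k IH h f mf f0].
  by rewrite !gauss_int0 (flatmx0 h) addr0 /shift_density dot0v mul0r subrr expR0 mule1.
change ('cV[R]_(1 + k)) in h; change ('cV[R]_(1 + k) -> \bar R) in f.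
have me : measurable_on_cV (fun v => (shift_density h v)%:E).
  by apply/measurable_EFinP; apply: measurable_shift_density;
    [exact: measurable_cV_cst|exact: measurable_cV_id].
rewrite gauss_intS; last 2 first.
- by apply: (measurable_on_cV_comp mf); apply: measurable_cVD;
    [exact: measurable_cV_id|exact: measurable_cV_cst].
- by [].
rewrite gauss_intS; last 2 first.
- exact: emeasurable_funM.
- by move=> v; rewrite mule_ge0// lee_fin shift_density_ge0.
set a := h (lshift k 0%R) 0%R; set b := dsubmx h.
have hE : h = col_mx a%:M b by exact: cV_split.
pose F (x : R) := gauss_int (fun v => f (col_mx x%:M v) * (shift_density b v)%:E).
have mfc : measurable_fun setT (fun z : R * k.-tuple R =>
    f (col_mx (z.1)%:M (vec_of_tuple z.2))).
  apply: (measurable_on_cV_comp mf); apply: (@measurable_cV_col_mx R _ _ 1 k);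
    first exact: measurable_cV_scalar.
  exact: measurable_cV_tuple.
have mfx (x : R) : measurable_on_cV (fun v => f (col_mx x%:M v)).
  apply: (measurable_on_cV_comp mf); apply: (@measurable_cV_col_mx R _ _ 1 k);
    first exact: measurable_cV_cst.
  exact: measurable_cV_id.
have mF : measurable_fun setT F.
  apply: measurable_gauss_int; last by move=> x v; rewrite mule_ge0// lee_fin shift_density_ge0.
  apply: emeasurable_funM => //; apply/measurable_EFinP; apply: measurable_shift_density.
    exact: measurable_cV_cst.
  exact: measurable_cV_tuple.
have F0 x : 0 <= F x.
  by apply: gauss_int_ge0 => v; rewrite mule_ge0// lee_fin shift_density_ge0.
transitivity (\int[N01]_x F (x + a)%R).
  apply: eq_integral => x _; rewrite /F -IH//.
  have hD v : (col_mx x%:M v + h = col_mx (x + a)%:M (v + b) :> 'cV_(1 + k))%R.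
    by rewrite {1}hE add_col_mx -scalar_mxD.
  by apply: eq_gauss_int => v; congr f; exact: hD.
apply: etrans; first exact: (normal_prob_shift a mF F0).
apply: eq_integral => x _; rewrite /F -gauss_intZr; last 3 first.
- apply: emeasurable_funM; first exact: mfx.
  apply/measurable_EFinP; apply: measurable_shift_density.
    exact: measurable_cV_cst.
  exact: measurable_cV_id.
- by move=> v; rewrite mule_ge0// lee_fin shift_density_ge0.
- by rewrite lee_fin expR_ge0.
apply: eq_gauss_int => v; rewrite -muleA -EFinM; congr (_ * _%:E).
rewrite -shift_density_col_mx.
exact: (congr1 (fun g => @shift_density (1 + k) g (col_mx x%:M v)) (esym hE)).
Qed.

(** The Cameron-Martin density has total mass [1]. *)
Lemma gauss_int_expR k (h : 'cV[R]_k) :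
  gauss_int (fun v => (expR (dotv h v))%:E) = (expR (dotv h h / 2))%:E.
Proof.
have := @gauss_int_shift k h (cst 1) (@measurable_cst _ _ _ _ _ _) (fun=> lee01).
rewrite gauss_int_cst => /(congr1 (fun t => (expR (dotv h h / 2))%:E * t)).
rewrite mule1 => ->; rewrite -gauss_intZl//.
- apply: eq_gauss_int => v; rewrite mul1e -EFinM /shift_density -expRD; congr (expR _)%:E.
  by rewrite addrC subrK.
- under eq_fun do rewrite mul1e; apply/measurable_EFinP; apply: measurable_shift_density.
    exact: measurable_cV_cst.
  exact: measurable_cV_id.
- by move=> v; rewrite mul1e lee_fin shift_density_ge0.
Qed.

(** The idea is that of the uniqueness of Haar measure.  The measure
    [psi * gauss] is, up to a constant, the Lebesgue measure, and
    [G = g / psi] is [g] times the Gaussian density.  The double integral [D]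
    of [G (x + O y) psi y], against the Gaussian law in [x] and in [y], is
    computed in both orders.  For fixed [y], translating [x] by [O y] and then
    integrating over [y] gives the right-hand side.  For fixed [x], since
    [x + O y = O (y + O^T x)], translating [y] by [O^T x] gives the left-hand
    side.  Only the translation formula and Tonelli's theorem are involved. *)
Lemma gauss_int_orth k (O : 'M[R]_k) (g : 'cV[R]_k -> \bar R) :
  (O^T *m O = 1%:M)%R -> measurable_on_cV g -> (forall v, 0 <= g v) ->
  gauss_int (fun v => g (O *m v)%R) = gauss_int g.
Proof.
move=> orthO mg g0; have orthOT : (O *m O^T = 1%:M)%R by apply: mulmx1C.
pose G v := g v * (expR (- (dotv v v / 2)))%:E.
have mG : measurable_on_cV G.
  apply: emeasurable_funM => //; apply/measurable_EFinP.
  apply: (measurableT_comp (@measurable_expR _)); apply: measurable_funN.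
  by apply: measurable_funM => //; apply: measurable_dotv; exact: measurable_cV_id.
have G0 v : 0 <= G v by rewrite /G mule_ge0// lee_fin expR_ge0.
pose psi (v : 'cV[R]_k) := expR (dotv v v / 2).
have psi0 v : 0 <= (psi v)%:E by rewrite lee_fin expR_ge0.
have mpsi d (T : measurableType d) (H : T -> 'cV[R]_k) : measurable_cV H ->
    measurable_fun setT (fun t => (psi (H t))%:E).
  move=> mH; apply/measurable_EFinP; apply: (measurableT_comp (@measurable_expR _)).
  by apply: measurable_funM => //; apply: measurable_dotv.
have me d (T : measurableType d) (H K : T -> 'cV[R]_k) : measurable_cV H -> measurable_cV K ->
    measurable_fun setT (fun t => (expR (dotv (H t) (K t)))%:E).
  move=> mH mK; apply/measurable_EFinP; apply: (measurableT_comp (@measurable_expR _)).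
  exact: measurable_dotv.
pose D := gauss_int (fun y => gauss_int (fun x => G (x + O *m y)%R * (psi y)%:E)).
transitivity D; last first.
  transitivity (gauss_int (fun y => gauss_int (fun x => G x * (expR (dotv (O *m y) x))%:E))).
    apply: eq_gauss_int => y; rewrite gauss_intZr//; last first.
      by apply: (measurable_on_cV_comp mG); apply: measurable_cVD;
        [exact: measurable_cV_id|exact: measurable_cV_cst].
    rewrite gauss_int_shift// -gauss_intZr//; last 2 first.
    - apply: emeasurable_funM => //; apply/measurable_EFinP; apply: measurable_shift_density.
        exact: measurable_cV_cst.
      exact: measurable_cV_id.
    - by move=> v; rewrite mule_ge0// lee_fin shift_density_ge0.
    apply: eq_gauss_int => x; rewrite -muleA -EFinM; congr (_ * _%:E).
    by rewrite /shift_density /psi -expRD dotv_orth// subrK.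
  rewrite gauss_int_swap; last 2 first.
  - apply: emeasurable_funM; first by apply: (measurable_on_cV_comp mG); exact: measurable_cV_tuple.
    by apply: me; [apply: measurable_cV_mulmx|]; exact: measurable_cV_tuple.
  - by move=> v w; rewrite mule_ge0// lee_fin expR_ge0.
  apply: eq_gauss_int => x; rewrite gauss_intZl//; last first.
    by apply: me; [apply: measurable_cV_mulmx; exact: measurable_cV_id|exact: measurable_cV_cst].
  under eq_gauss_int do rewrite dotv_mulmxl dotvC.
  rewrite gauss_int_expR dotv_orth ?trmxK// /G -muleA -EFinM -expRD addNr expR0.
  by rewrite mule1.
rewrite /D gauss_int_swap; last 2 first.
- apply: emeasurable_funM; last by apply: mpsi; exact: measurable_cV_tuple.
  apply: (measurable_on_cV_comp mG); apply: measurable_cVD; last apply: measurable_cV_mulmx;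
    exact: measurable_cV_tuple.
- by move=> v w; rewrite mule_ge0.
rewrite -[LHS](gauss_int_cst k); apply: eq_gauss_int => x.
pose f y := G (O *m y)%R * (psi (y - O^T *m x)%R)%:E.
have mf : measurable_on_cV f.
  apply: emeasurable_funM.
    by apply: (measurable_on_cV_comp mG); apply: measurable_cV_mulmx; exact: measurable_cV_id.
  by apply: mpsi; apply: measurable_cVD; [exact: measurable_cV_id|exact: measurable_cV_cst].
transitivity (gauss_int (fun y => f (y + O^T *m x)%R)); last first.
  apply: eq_gauss_int => y; rewrite /f mulmxDr mulmxA orthOT mul1mx addrC addrK.
  by [].
rewrite gauss_int_shift//; last by move=> v; rewrite /f mule_ge0.
apply: eq_gauss_int => y; rewrite /f /G /psi /shift_density -!muleA -!EFinM -!expRD dotv_orth//.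
rewrite (_ : _ + _ = 0)%R ?expR0 ?mule1//.
rewrite !(dotvDl, dotvDr, dotvNl, dotvNr) (dotvC y (O^T *m x)).
by field.
Qed.

Lemma gauss_int_col_mx k l (f : 'cV[R]_(k + l) -> \bar R) :
  measurable_on_cV f -> (forall v, 0 <= f v) ->
  gauss_int f = gauss_int (fun v => gauss_int (fun w => f (col_mx v w))).
Proof.
elim: k f => [f mf f0|k IH f mf f0].
  rewrite gauss_int0; apply: eq_gauss_int => w; congr f; apply/colP => i.
  rewrite mxE; case: fintype.splitP => [[]//|j ij]; congr (w _ _).
  exact/val_inj.
change ('cV[R]_(1 + (k + l)) -> \bar R) in f.
rewrite gauss_intS// gauss_intS; last 2 first.
- apply: (@measurable_gauss_int _ (k.+1.-tuple R) l (fun z w => f (col_mx (vec_of_tuple z) w))) => //.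
  by apply: (measurable_on_cV_comp mf); apply: (@measurable_cV_col_mx R _ _ k.+1 l);
    exact: measurable_cV_tuple.
- by move=> v; exact: gauss_int_ge0.
apply: eq_integral => x _; rewrite IH; last 2 first.
- apply: (measurable_on_cV_comp mf); apply: (@measurable_cV_col_mx R _ _ 1 (k + l)).
    exact: measurable_cV_cst.
  exact: measurable_cV_id.
- by move=> v; exact: f0.
apply: eq_gauss_int => v; apply: eq_gauss_int => w; congr f.
by rewrite col_mxA castmx_id.
Qed.

(** By rotation invariance [v] may be replaced with [|v| e1]. *)
Lemma gauss_int_dotv k (v : 'cV[R]_(1 + k)) (f : R -> \bar R) :
  measurable_fun setT f -> (forall x, 0 <= f x) ->
  gauss_int (fun z => f (dotv v z)) = \int[N01]_x f (Num.sqrt (dotv v v) * x)%R.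
Proof.
move=> mf f0; have [Q orthO Ov] := householder v.
have md (u : 'cV[R]_(1 + k)) : measurable_on_cV (fun z => f (dotv u z)).
  by apply: measurableT_comp => //; apply: measurable_dotv;
    [exact: measurable_cV_cst|exact: measurable_cV_id].
transitivity (gauss_int (fun z => f (dotv (Q *m v) z)%R)).
  rewrite -[RHS](gauss_int_orth orthO)//; apply: eq_gauss_int => z.
  by rewrite dotv_orth.
rewrite Ov gauss_intS//; apply: eq_integral => x _.
rewrite -[RHS](gauss_int_cst k); apply: eq_gauss_int => z.
by rewrite dotv_col_mx dot0v addr0 dotv_scalar.
Qed.

(** The plane rotation of matrix [[a, b; - b, a]] over [sqrt (a^2 + b^2)],
    acting on blocks, makes the combination a multiple of the first block. *)
Lemma gauss_int_sum k (a b : R) (g : 'cV[R]_k -> \bar R) :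
  measurable_on_cV g -> (forall v, 0 <= g v) ->
  gauss_int (fun v => gauss_int (fun w => g (a *: v + b *: w)%R)) =
  gauss_int (fun v => g (Num.sqrt (a ^+ 2 + b ^+ 2) *: v)%R).
Proof.
move=> mg g0; set c := Num.sqrt _.
have c2 : (c ^+ 2 = a ^+ 2 + b ^+ 2)%R by rewrite sqr_sqrtr// addr_ge0// sqr_ge0.
have [c0|c0] := eqVneq c 0%R.
  have [a0 b0] : (a = 0 /\ b = 0)%R.
    move: c2; rewrite c0 expr0n/= => /esym/eqP.
    by rewrite paddr_eq0 ?sqr_ge0// !sqrf_eq0 => /andP[/eqP-> /eqP->].
  rewrite c0; apply: eq_gauss_int => v; rewrite a0 b0 scale0r.
  by under eq_gauss_int do rewrite !scale0r addr0; rewrite gauss_int_cst.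
pose O : 'M[R]_(k + k) := (block_mx (a / c)%:M (b / c)%:M (- (b / c))%:M (a / c)%:M)%R.
have orthO : (O^T *m O = 1%:M)%R.
  rewrite /O tr_block_mx !tr_scalar_mx mulmx_block -!scalar_mxM -!scalar_mxD.
  rewrite scalar_mx_block; congr block_mx.
  - by congr _%:M; apply: (mulIf (expf_neq0 2 c0)); rewrite mul1r [RHS]c2; field.
  - rewrite (_ : (_ + _ = 0)%R); last by ring.
    by apply/matrixP => i j; rewrite !mxE mul0rn.
  - rewrite (_ : (_ + _ = 0)%R); last by ring.
    by apply/matrixP => i j; rewrite !mxE mul0rn.
  - by congr _%:M; apply: (mulIf (expf_neq0 2 c0)); rewrite mul1r [RHS]c2; field.
pose f (V : 'cV[R]_(k + k)) := g (c *: usubmx V)%R.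
have mf : measurable_on_cV f.
  by apply: (measurable_on_cV_comp mg); apply: measurable_cVZ; apply: measurable_cV_usubmx;
    exact: measurable_cV_id.
transitivity (gauss_int (fun V => f (O *m V)%R)).
  rewrite gauss_int_col_mx; last 2 first.
  - by apply: (measurable_on_cV_comp mf); apply: measurable_cV_mulmx; exact: measurable_cV_id.
  - by move=> V; exact: g0.
  apply: eq_gauss_int => v; apply: eq_gauss_int => w; rewrite /f /O mul_block_col col_mxKu.
  rewrite !mul_scalar_mx scalerDr !scalerA.
  by rewrite ![(c * (_ / c))%R]mulrC !divfK.
have f0 V : 0 <= f V by exact: g0.
rewrite (gauss_int_orth orthO mf f0) (gauss_int_col_mx mf f0); apply: eq_gauss_int => v.
by rewrite -[RHS](gauss_int_cst k); apply: eq_gauss_int => w; rewrite /f col_mxKu.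
Qed.

End gaussian_vector.

(** * Inverse moments and the expected angle *)

Section inverse_moment.
Context {R : realType}.
Notation mu := (@lebesgue_measure R).
Notation N01 := (normal_prob (0 : R) 1).
Notation gauss k := (product_prob (normal_prob (0 : R) 1) k).

Lemma measurable_mgf d (T : measurableType d) k (g : T -> R) (G : T -> 'cV[R]_k) :
  measurable_fun setT g -> measurable_cV G ->
  measurable_fun setT (fun t => expR (- ((g t ^+ 2 - 1) * (dotv (G t) (G t) / 2)))).
Proof.
move=> mg mG; apply: (measurableT_comp (@measurable_expR _)).
apply: measurable_funN; apply: measurable_funM.
  by apply: measurable_funD => //; exact: measurable_funX.
by apply: measurable_funM => //; exact: measurable_dotv.
Qed.

Lemma gauss_int_mgf k (u : R) : 0 < u ->
  gauss_int (fun v : 'cV[R]_k => (expR (- ((u ^+ 2 - 1) * (dotv v v / 2))))%:E) =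
  ((u^-1) ^+ k)%:E.
Proof.
move=> u0; elim: k => [|k IH].
  by rewrite gauss_int0 dot0v mul0r mulr0 oppr0 expR0.
have me l : measurable_on_cV (fun v : 'cV[R]_l => (expR (- ((u ^+ 2 - 1) * (dotv v v / 2))))%:E).
  by apply/measurable_EFinP; apply: measurable_mgf => //; exact: measurable_cV_id.
have e0 l (v : 'cV[R]_l) : (0 <= (expR (- ((u ^+ 2 - 1) * (dotv v v / 2))))%:E)%E.
  by rewrite lee_fin expR_ge0.
rewrite (gauss_intS (me k.+1) (e0 k.+1)).
transitivity (\int[N01]_x ((expR (- ((u ^+ 2 - 1) * (x ^+ 2 / 2))))%:E *
    ((u^-1) ^+ k)%:E))%E.
  apply: eq_integral => x _; rewrite -IH -gauss_intZl; last 3 first.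
  - exact: me.
  - exact: e0.
  - by rewrite lee_fin expR_ge0.
  apply: eq_gauss_int => v; rewrite -EFinM -expRD; congr (expR _)%:E.
  by rewrite (@dotv_col_mx R 1 k) dotv_scalar; field.
rewrite ge0_integralZr; last 4 first.
- exact: measurableT.
- by measurable_auto.
- by move=> x _; rewrite lee_fin expR_ge0.
- by rewrite lee_fin exprn_ge0// invr_ge0 ltW.
by rewrite normal_prob_mgf// -EFinM exprS.
Qed.

(** From [1 / d = int_(1/2)^oo exp (- (t - 1/2) d) dt] with [t = u^2 / 2], a
    form in which the Gaussian integral [gauss_int_mgf] applies under the
    integral sign.  Only the inequality survives at [d = 0], where the inverse
    is [0] by convention. *)
Lemma inv_laplace (d : R) : 0 <= d ->
  ((d^-1)%:E <= \int[mu]_(u in `[1%R, +oo[) (u * expR (- ((u ^+ 2 - 1) * (d / 2))))%:E)%E.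
Proof.
rewrite le_eqVlt => /predU1P[<-|d0].
  rewrite invr0; apply: integral_ge0 => u /=; rewrite in_itv/= andbT => u1.
  by rewrite lee_fin mulr_ge0 ?expR_ge0// (le_trans _ u1).
have -> : (\int[mu]_(u in `[1%R, +oo[) (u * expR (- ((u ^+ 2 - 1) * (d / 2))))%:E =
    \int[mu]_(u in `[1%R, +oo[) ((expR (d / 2))%:E * (u * expR (- (d * (u ^+ 2 / 2))))%:E))%E.
  apply: eq_integral => u _; rewrite -EFinM [in RHS]mulrCA -expRD; congr (_ * expR _)%:E.
  by field.
rewrite ge0_integralZl//; last 2 first.
- by apply: measurable_funTS; measurable_auto.
- by move=> u /=; rewrite in_itv/= andbT => u1;
    rewrite lee_fin mulr_ge0 ?expR_ge0// (le_trans _ u1).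
rewrite integral_x_gauss// -EFinM lee_fin [leRHS]mulrA -expRD expr1n.
rewrite (_ : _ + _ = 0) ?expR0 ?mul1r//.
by field.
Qed.

(** Exchanging the integrals turns the bound [inv_laplace] into the integral
    over [u >= 1] of [u * u^-(k+3)], that is [1 / (k + 1)].  Convergence needs
    dimension at least three. *)
Lemma gauss_int_inv_sqr k :
  (gauss_int (fun v : 'cV[R]_(k.+3) => ((dotv v v)^-1)%:E) <= (k.+1%:R^-1)%:E)%E.
Proof.
pose H (z : (k.+3).-tuple R * R) : \bar R := ((1 <= z.2)%R%:R%:E *
  (z.2 * expR (- ((z.2 ^+ 2 - 1) * (dotv (vec_of_tuple z.1) (vec_of_tuple z.1) / 2))))%:E)%E.
have H0 z : (0 <= H z)%E.
  rewrite /H; case: (leP 1 z.2) => z1; last by rewrite mul0e.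
  by rewrite mul1e lee_fin mulr_ge0 ?expR_ge0// (le_trans _ z1).
have mH : measurable_fun setT H.
  apply: emeasurable_funM; apply/measurable_EFinP.
    by apply: measurable_boolR; exact: measurable_fun_ler.
  apply: measurable_funM => //; apply: measurable_mgf => //.
  exact: measurable_cV_tuple.
have HE (z : (k.+3).-tuple R) : (\int[mu]_(u in `[1%R, +oo[)
    (u * expR (- ((u ^+ 2 - 1) * (dotv (vec_of_tuple z) (vec_of_tuple z) / 2))))%:E =
    \int[mu]_u H (z, u))%E.
  rewrite (integral_boolM (mu : {measure set (measurableTypeR R) -> \bar R})).
  rewrite (_ : [set u | 1 <= u] = `[1%R, +oo[%classic)//.
  by apply/seteqP; split => u /=; rewrite in_itv/= andbT.
apply: (@le_trans _ _ (\int[gauss k.+3]_z \int[mu]_u H (z, u))%E).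
  apply: ge0_le_integral.
  - exact: measurableT.
  - by move=> z _; rewrite lee_fin invr_ge0 dotv_ge0.
  - apply/measurable_EFinP; apply: measurable_funV.
    by apply: measurable_dotv; exact: measurable_cV_id.
  - exact: (@measurable_fun_fubini_tonelli_F _ _ _ (measurableTypeR R) _ mu H).
  - by move=> z _; rewrite -HE; apply: inv_laplace; exact: dotv_ge0.
have -> := @fubini_tonelli _ _ _ (measurableTypeR R) R (gauss k.+3) mu H mH H0.
rewrite -integral_invX (_ : `[1%R, +oo[%classic = [set u : R | 1 <= u]); last first.
  by apply/seteqP; split => u /=; rewrite in_itv/= andbT.
rewrite -(integral_boolM (mu : {measure set (measurableTypeR R) -> \bar R})).
rewrite le_eqVlt; apply/orP; left; apply/eqP; apply: eq_integral => u _; rewrite /H/=.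
have [u1|u1] := leP 1 u; last first.
  by rewrite mul0e integral0_eq// => z _; rewrite mul0e.
rewrite mul1e; have u0 : 0 < u by rewrite (lt_le_trans _ u1).
transitivity (u%:E * gauss_int (fun v : 'cV[R]_(k.+3) => (expR (- ((u ^+ 2 - 1) * (dotv v v / 2))))%:E))%E.
  rewrite -gauss_intZl; last 3 first.
  - by apply/measurable_EFinP; apply: measurable_mgf => //; exact: measurable_cV_id.
  - by move=> v; rewrite lee_fin expR_ge0.
  - by rewrite lee_fin ltW.
  by apply: eq_integral => z _; rewrite mul1e EFinM.
by rewrite gauss_int_mgf// -EFinM (exprS _ k.+2) mulVKf// gt_eqF.
Qed.

Lemma measurable_norm_inv d (T : measurableType d) k (G : T -> 'cV[R]_k) :
  measurable_cV G -> measurable_fun setT (fun t => (Num.sqrt (dotv (G t) (G t)))^-1).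
Proof.
move=> mG; apply: measurable_funV.
apply: (measurableT_comp (f := @Num.sqrt R)); last exact: measurable_dotv.
by apply: continuous_measurable_fun; exact: sqrt_continuous.
Qed.

(** The Cauchy-Schwarz inequality applied to [gauss_int_inv_sqr], in the form
    [2 y <= 1 / s + s y^2]. *)
Lemma gauss_int_inv_norm k :
  (gauss_int (fun v : 'cV[R]_(k.+3) => ((Num.sqrt (dotv v v))^-1)%:E) <=
   ((Num.sqrt k.+1%:R)^-1)%:E)%E.
Proof.
set s := Num.sqrt _; have s0 : 0 < s by rewrite sqrtr_gt0 ltr0n.
have s2 : s ^+ 2 = k.+1%:R by rewrite sqr_sqrtr// ler0n.
have mI : measurable_on_cV (fun v : 'cV[R]_(k.+3) => ((dotv v v)^-1)%:E).
  by apply/measurable_EFinP; apply: measurable_funV; apply: measurable_dotv;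
    exact: measurable_cV_id.
have I0 (v : 'cV[R]_(k.+3)) : (0 <= ((dotv v v)^-1)%:E)%E.
  by rewrite lee_fin invr_ge0 dotv_ge0.
apply: (@le_trans _ _ (gauss_int (fun v : 'cV[R]_(k.+3) =>
    ((2 * s)^-1)%:E + (s / 2)%:E * ((dotv v v)^-1)%:E)%E)).
  apply: le_gauss_int.
  - by apply/measurable_EFinP; apply: measurable_norm_inv; exact: measurable_cV_id.
  - by apply: emeasurable_funD => //; exact: emeasurable_funM.
  - by move=> v; rewrite lee_fin invr_ge0 sqrtr_ge0.
  - move=> v; rewrite -EFinM -EFinD lee_fin.
    set y := (Num.sqrt _)^-1.
    have -> : (dotv v v)^-1 = y ^+ 2 by rewrite /y exprVn sqr_sqrtr// dotv_ge0.
    rewrite -subr_ge0 (_ : _ - _ = (s * y - 1) ^+ 2 / (2 * s)).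
      by rewrite divr_ge0 ?sqr_ge0// mulr_ge0// ltW.
    by field; rewrite gt_eqF.
rewrite gauss_intD; last 4 first.
- exact: measurable_cst.
- exact: emeasurable_funM.
- by move=> v; rewrite lee_fin invr_ge0 mulr_ge0// ltW.
- by move=> v; rewrite mule_ge0// lee_fin divr_ge0// ltW.
rewrite gauss_int_cst gauss_intZl; last 3 first.
- exact: mI.
- exact: I0.
- by rewrite lee_fin divr_ge0// ltW.
apply: (@le_trans _ _ (((2 * s)^-1)%:E + (s / 2)%:E * (k.+1%:R^-1)%:E)%E).
  apply: leeD2l; apply: lee_wpmul2l; last exact: gauss_int_inv_sqr.
  by rewrite lee_fin divr_ge0// ltW.
rewrite -EFinM -EFinD lee_fin -s2 le_eqVlt; apply/orP; left; apply/eqP.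
by field; rewrite gt_eqF.
Qed.

(** The first coordinate of a standard Gaussian vector has no atom. *)
Lemma gauss_int_eq0 k : gauss_int (fun v : 'cV[R]_(k.+1) => (v == 0)%:R%:E) = 0%E.
Proof.
have m0 : measurable_on_cV (fun v : 'cV[R]_(k.+1) => (v == 0)%:R%:E).
  apply/measurable_EFinP; apply: measurable_boolR.
  under eq_fun do rewrite -dotv_eq0; apply: measurable_fun_eqr => //.
  by apply: measurable_dotv; exact: measurable_cV_id.
rewrite (gauss_intS m0); last by move=> v; rewrite lee_fin ler0n.
apply/eqP; rewrite eq_le; apply/andP; split; last first.
  by apply: integral_ge0 => x _; apply: gauss_int_ge0 => v; rewrite lee_fin ler0n.
apply: (@le_trans _ _ (\int[N01]_x (x == 0)%:R%:E)%E); last first.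
  have z : [set x : R | x == 0] = [set 0] by apply/seteqP; split => x /eqP.
  rewrite integral_bool; last by rewrite z.
  by rewrite z [leLHS]normal_prob_set1.
apply: ge0_le_integral.
- exact: measurableT.
- by move=> x _; apply: gauss_int_ge0 => v; rewrite lee_fin ler0n.
- apply: (@measurable_gauss_int R _ R k (fun x v => (col_mx x%:M v == 0 :> 'cV_(1 + k))%:R%:E)).
    apply: (measurable_on_cV_comp m0); apply: (@measurable_cV_col_mx R _ _ 1 k).
      exact: measurable_cV_scalar.
    exact: measurable_cV_tuple.
  by move=> x v; rewrite lee_fin ler0n.
- by apply/measurable_EFinP; apply: measurable_boolR; exact: measurable_fun_eqr.
- move=> x _; rewrite -[leRHS](gauss_int_cst k); apply: le_gauss_int.
  - apply: (measurable_on_cV_comp m0); apply: (@measurable_cV_col_mx R _ _ 1 k).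
      exact: measurable_cV_cst.
    exact: measurable_cV_id.
  - exact: measurable_cst.
  - by move=> v; rewrite lee_fin ler0n.
  - move=> v; rewrite lee_fin; case: (eqVneq x 0) => [_|x0]; first by case: eqP.
    case: eqP => // /(congr1 (@usubmx _ 1 k 1)); rewrite (@col_mxKu _ 1 k) linear0.
    by move/(congr1 (fun A : 'cV[R]_1 => A 0 0)); rewrite !mxE eqxx mulr1n => /eqP;
      rewrite (negbTE x0).
Qed.

(** The angle between the first axis and the line spanned by [(X, w)], in
    [[0, pi / 2]].  The value [0] at [w = 0] has to be set separately because
    division by [0] returns [0], which would give [pi / 2]. *)
Definition acute_angle (X : R) k (w : 'cV[R]_k) : R :=
  if w == 0 then 0 else pi / 2 - atan (`|X| / Num.sqrt (dotv w w)).

Lemma acute_angle_ge0 (X : R) k (w : 'cV[R]_k) : 0 <= acute_angle X w.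
Proof.
by rewrite /acute_angle; case: ifP => // _; rewrite subr_ge0 ltW// atan_ltpi2.
Qed.

Lemma measurable_acute_angle d (T : measurableType d) k (g : T -> R) (G : T -> 'cV[R]_k) :
  measurable_fun setT g -> measurable_cV G ->
  measurable_fun setT (fun t => acute_angle (g t) (G t)).
Proof.
move=> mg mG; apply: measurable_fun_ifT => //.
  under eq_fun do rewrite -dotv_eq0; apply: measurable_fun_eqr => //.
  exact: measurable_dotv.
apply: measurable_funB => //; apply: (measurableT_comp (f := @atan R)).
  apply: continuous_measurable_fun; exact: continuous_atan.
apply: measurable_funM; last exact: measurable_norm_inv.
exact: (measurableT_comp (@normr_measurable _ setT)).
Qed.

(** Jensen's inequality for the concave [atan], through its tangent at
    [t0 = s * (a + 1)], a bound for the mean of [|a + x| / |w|] by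
    [gauss_int_inv_norm] and [normal_prob_abs]. *)
Lemma gauss_int_angle k (a : R) : 0 <= a ->
  ((pi / 2 - atan ((Num.sqrt k.+1%:R)^-1 * (a + 1)))%:E <=
   \int[N01]_x gauss_int (fun w : 'cV[R]_(k.+3) => (acute_angle (a + x) w)%:E))%E.
Proof.
move=> a0; set s := (Num.sqrt _)^-1.
have s0 : 0 <= s by rewrite invr_ge0 sqrtr_ge0.
set t0 := s * (a + 1); have t00 : 0 <= t0 by rewrite mulr_ge0// addr_ge0.
pose c := (1 + t0 ^+ 2)^-1; have c0 : 0 <= c by rewrite invr_ge0 addr_ge0// sqr_ge0.
(* On the null set [w = 0] the tangent bound fails, both the angle and the
   inverse norm being [0] there; [M] makes up for it without being seen by
   the integral. *)
pose M := pi / 2 + c * t0.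
have M0 : 0 <= M.
  by apply: addr_ge0; [rewrite divr_ge0 ?pi_ge0|exact: mulr_ge0].
have kap0 : 0 <= pi / 2 - atan t0 + c * t0.
  by apply: addr_ge0; [rewrite subr_ge0 ltW// atan_ltpi2|exact: mulr_ge0].
pose r (w : 'cV[R]_(k.+3)) := (Num.sqrt (dotv w w))^-1.
have r0 w : 0 <= r w by rewrite invr_ge0 sqrtr_ge0.
have mr : measurable_on_cV (fun w => (r w)%:E).
  by apply/measurable_EFinP; apply: measurable_norm_inv; exact: measurable_cV_id.
have mz : measurable_on_cV (fun v : 'cV[R]_(k.+3) => (v == 0)%:R%:E).
  apply/measurable_EFinP; apply: measurable_boolR.
  under eq_fun do rewrite -dotv_eq0; apply: measurable_fun_eqr => //.
  by apply: measurable_dotv; exact: measurable_cV_id.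
have ptw x w : pi / 2 - atan t0 + c * t0 <=
    acute_angle (a + x) w + c * `|a + x| * r w + M * (w == 0)%:R.
  rewrite /acute_angle; case: ifP => [w0|w0].
    rewrite add0r mulr1 ler_wpDl ?mulr_ge0//.
    rewrite /M lerD2r gerBl -(@atan0 R) le_atan//.
  rewrite mulr0 addr0 -/(r w) -mulrA.
  have t1 : 0 <= `|a + x| * r w by rewrite mulr_ge0.
  have := atan_tangent t00 t1; rewrite -/c; lra.
pose I x := gauss_int (fun w : 'cV[R]_(k.+3) => (acute_angle (a + x) w)%:E).
pose K := gauss_int (fun w => (r w)%:E).
have K0 : (0 <= K)%E by apply: gauss_int_ge0 => w; rewrite lee_fin.
have ang0 x (w : 'cV[R]_(k.+3)) : (0 <= (acute_angle (a + x) w)%:E)%E by rewrite lee_fin acute_angle_ge0.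
have mI : measurable_fun setT I.
  apply: (@measurable_gauss_int R _ R (k.+3) (fun x w => (acute_angle (a + x) w)%:E)) => //.
  apply/measurable_EFinP; apply: measurable_acute_angle; last exact: measurable_cV_tuple.
  exact: measurable_funD.
have I0 x : (0 <= I x)%E by apply: gauss_int_ge0.
have inner x : ((pi / 2 - atan t0 + c * t0)%:E <= I x + (c * `|a + x|)%:E * K)%E.
  rewrite -[leLHS](gauss_int_cst k.+3).
  have cx0 : (0 <= (c * `|a + x|)%:E)%E by rewrite lee_fin mulr_ge0.
  have mang : measurable_on_cV (fun w : 'cV[R]_(k.+3) => (acute_angle (a + x) w)%:E).
    apply/measurable_EFinP; apply: measurable_acute_angle; last exact: measurable_cV_id.
    exact: measurable_cst.
  have mcr : measurable_on_cV (fun w => ((c * `|a + x|)%:E * (r w)%:E)%E).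
    exact: emeasurable_funM.
  have mMz : measurable_on_cV (fun w : 'cV[R]_(k.+3) => (M%:E * (w == 0)%:R%:E)%E).
    exact: emeasurable_funM.
  have z0 (w : 'cV[R]_(k.+3)) : (0 <= (w == 0)%:R%:E :> \bar R)%E by rewrite lee_fin ler0n.
  have cr0 w : (0 <= (c * `|a + x|)%:E * (r w)%:E)%E by rewrite mule_ge0// lee_fin.
  have Mz0 (w : 'cV[R]_(k.+3)) : (0 <= M%:E * (w == 0)%:R%:E)%E by rewrite mule_ge0.
  apply: (@le_trans _ _ (gauss_int (fun w : 'cV[R]_(k.+3) => (acute_angle (a + x) w)%:E
      + (c * `|a + x|)%:E * (r w)%:E + M%:E * (w == 0)%:R%:E)%E)).
    apply: le_gauss_int.
    - exact: measurable_cst.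
    - by apply: emeasurable_funD => //; exact: emeasurable_funD.
    - by move=> w; rewrite lee_fin.
    - by move=> w; rewrite -!EFinM -!EFinD lee_fin.
  rewrite gauss_intD; last 4 first.
  - exact: emeasurable_funD.
  - exact: mMz.
  - by move=> w; rewrite adde_ge0.
  - exact: Mz0.
  rewrite gauss_intD; last 4 first.
  - exact: mang.
  - exact: mcr.
  - exact: ang0.
  - exact: cr0.
  rewrite (gauss_intZl mz z0); last by rewrite lee_fin.
  by rewrite gauss_int_eq0 mule0 adde0 (gauss_intZl mr).
have mabs : measurable_fun setT (fun x : R => (`|a + x|)%:E).
  apply/measurable_EFinP; apply: (measurableT_comp (@normr_measurable _ setT)).
  exact: measurable_funD.
have outer : ((pi / 2 - atan t0 + c * t0)%:E <=
    \int[N01]_x I x + (c * t0)%:E)%E.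
  apply: (@le_trans _ _ (\int[N01]_x (I x + c%:E * K * (`|a + x|)%:E))%E).
    rewrite -[leLHS]mule1 -(probability_setT N01) -integral_cst//.
    apply: ge0_le_integral.
    - exact: measurableT.
    - by move=> x _; rewrite lee_fin.
    - exact: measurable_cst.
    - by apply: emeasurable_funD => //; exact: emeasurable_funM.
    - by move=> x _; rewrite muleAC -EFinM; exact: inner.
  have cK0 : (0 <= c%:E * K)%E by rewrite mule_ge0.
  rewrite ge0_integralD; last 5 first.
  - exact: measurableT.
  - by move=> x _.
  - exact: mI.
  - by move=> x _; rewrite mule_ge0// lee_fin.
  - exact: emeasurable_funM.
  apply: leeD2l; rewrite ge0_integralZl//.
  rewrite /t0 (EFinM c) -muleA; apply: lee_wpmul2l; first by rewrite lee_fin.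
  rewrite (EFinM s); apply: lee_pmul => //.
  - by apply: integral_ge0 => x _; rewrite lee_fin.
  - exact: gauss_int_inv_norm.
  apply: (@le_trans _ _ (\int[N01]_x (a%:E + `|x|%:E))%E).
    apply: ge0_le_integral.
    - exact: measurableT.
    - by move=> x _; rewrite lee_fin.
    - exact: mabs.
    - by measurable_auto.
    - by move=> x _; rewrite -EFinD lee_fin (le_trans (ler_normD _ _))// ger0_norm.
  rewrite ge0_integralD; last 5 first.
  - exact: measurableT.
  - by move=> x _; rewrite lee_fin.
  - exact: measurable_cst.
  - by move=> x _; rewrite lee_fin.
  - by measurable_auto.
  rewrite integral_cst//= probability_setT mule1 EFinD.
  by apply: leeD2l; exact: normal_prob_abs.
move: outer; rewrite EFinD leeD2rE//.
Qed.

End inverse_moment.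

(** * Gaussian laws in whitened coordinates *)

Section gaussian_laws.
Context {R : realType}.
Notation N01 := (normal_prob (0 : R) 1).
Notation gauss k := (product_prob (normal_prob (0 : R) 1) k).

(** Two invertible factors of the same covariance differ by an orthogonal
    matrix, to which a standard Gaussian vector is insensitive. *)
Lemma gaussian_integral k (m : 'cV[R]_k) (C B : 'M[R]_k)
    (P : probability (k.-tuple R) R) (f : 'cV[R]_k -> \bar R) :
  gaussian m C P -> B *m B^T = C -> B \in unitmx ->
  measurable_on_cV f -> (forall v, 0 <= f v)%E ->
  (\int[P]_x f (vec_of_tuple x) = gauss_int (fun z => f (m + B *m z)%R))%E.
Proof.
move=> [A AA PE] BB uB mf f0.
have mphi : measurable_fun setT (fun z : k.-tuple R => tuple_of_vec (m + A *m vec_of_tuple z)).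
  apply: measurable_tuple_of_vec; apply: measurable_cVD; first exact: measurable_cV_cst.
  by apply: measurable_cV_mulmx; exact: measurable_cV_id.
transitivity (\int[pushforward (gauss k)
    (fun z => tuple_of_vec (m + A *m vec_of_tuple z))]_x f (vec_of_tuple x))%E.
  by apply: eq_measure_integral => S mS _; exact: PE.
rewrite ge0_integral_pushforward//= preimage_setT.
pose Q := invmx B *m A.
have BQ : B *m Q = A by rewrite /Q mulKVmx.
have QQ : Q^T *m Q = 1%:M.
  apply: mulmx1C; rewrite /Q trmx_mul mulmxA -(mulmxA _ A) AA -BB mulmxA mulVmx//.
  by rewrite mul1mx -trmx_mul mulVmx// trmx1.
have mfB : measurable_on_cV (fun z => f (m + B *m z)).
  apply: (measurable_on_cV_comp mf); apply: measurable_cVD; first exact: measurable_cV_cst.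
  by apply: measurable_cV_mulmx; exact: measurable_cV_id.
rewrite -(gauss_int_orth QQ mfB)//; apply: eq_integral => z _.
by rewrite tuple_of_vecK mulmxA BQ.
Qed.

Lemma gaussian_bool k (m : 'cV[R]_k) (C B : 'M[R]_k)
    (P : probability (k.-tuple R) R) (b : 'cV[R]_k -> bool) :
  gaussian m C P -> B *m B^T = C -> B \in unitmx ->
  measurable_fun setT (fun x => b (vec_of_tuple x)) ->
  P [set x | b (vec_of_tuple x)] = gauss_int (fun z => (b (m + B *m z))%:R%:E).
Proof.
move=> gP BB uB mb; have mS : measurable [set x | b (vec_of_tuple x)].
  by rewrite -[X in measurable X]setTI; exact: (mb measurableT [set true]).
rewrite -(integral_bool P mS).
apply: (gaussian_integral (f := fun v => (b v)%:R%:E) gP BB uB) => [|v].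
  by apply/measurable_EFinP; exact: measurable_boolR.
by rewrite lee_fin ler0n.
Qed.

Lemma posdef_unit k (C : 'M[R]_k) : posdef C -> C \in unitmx.
Proof.
move=> [CT Cpos]; rewrite -row_free_unit -kermx_eq0; apply/eqP/row_matrixP => i.
rewrite row0; apply/eqP; apply: contraT => v0.
set v := row i (kermx C) in v0.
have vC : v *m C = 0 by rewrite /v -row_mul mulmx_ker row0.
have u0 : v^T != 0 by rewrite trmx_eq0.
have := Cpos _ u0; rewrite -[X in X *m _]CT -trmx_mul vC trmx0.
by rewrite dotvC dot0v ltxx.
Qed.

(** Compose any factor with the reflection that brings [A^-1 m] onto the
    first axis. *)
Lemma whitening k (C A : 'M[R]_(1 + k)) (m : 'cV[R]_(1 + k)) :
  posdef C -> A *m A^T = C ->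
  exists B L, [/\ 0 <= L, B *m B^T = C, B \in unitmx & m = B *m col_mx L%:M 0].
Proof.
move=> pC AA; have uA : A \in unitmx.
  by have := posdef_unit pC; rewrite -AA unitmx_mul => /andP[].
have [Q QQ Qv] := householder (invmx A *m m).
have QQT : Q *m Q^T = 1%:M by exact: mulmx1C.
exists (A *m Q^T), (Num.sqrt (dotv (invmx A *m m) (invmx A *m m))); split.
- exact: sqrtr_ge0.
- by rewrite trmx_mul trmxK mulmxA -(mulmxA A) QQ mulmx1.
- by rewrite unitmx_mul uA/=; have [_] := mulmx1_unit QQT.
- by rewrite -Qv -mulmxA (mulmxA Q^T) QQ mul1mx mulKVmx.
Qed.

(** The form [C^-1] is the Euclidean product in the coordinates [B^-1 x]. *)
Lemma dotv_whiten k (C B : 'M[R]_k) (u z : 'cV[R]_k) :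
  B *m B^T = C -> C \in unitmx ->
  dotv (invmx C *m (B *m u)) (B *m z) = dotv u z.
Proof.
move=> BB uC; have BC : B^T *m invmx C *m B = 1%:M.
  by apply: mulmx1C; rewrite mulmxA BB mulmxV.
by rewrite dotvC dotv_mulmxl !mulmxA BC mul1mx dotvC.
Qed.

(** In whitened coordinates the linear form is [L] times a standard normal
    variable. *)
Lemma L2norm_gaussian k (C B : 'M[R]_(1 + k)) (L : R)
    (P : probability ((1 + k).-tuple R) R) :
  gaussian 0 C P -> B *m B^T = C -> B \in unitmx -> C \in unitmx -> 0 <= L ->
  L2norm P (invmx C *m (B *m col_mx L%:M 0)) = L.
Proof.
move=> gP BB uB uC L0; rewrite /L2norm unlock.
set F := invmx C *m _.
transitivity (fine ((L ^+ 2)%:E `^ (2^-1))%E); last first.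
  by rewrite poweR_EFin/= powR12_sqrt ?sqr_ge0// sqrtr_sqr ger0_norm.
congr (fine (_ `^ _)%E).
transitivity (\int[P]_x ((dotv F (vec_of_tuple x)) ^+ 2)%:E)%E.
  apply: eq_integral => x _; rewrite abse_EFin poweR_EFin.
  by rewrite (powR_mulrn 2)// real_normK// num_real.
rewrite (gaussian_integral (f := fun v => ((dotv F v) ^+ 2)%:E) gP BB uB); last 2 first.
- apply/measurable_EFinP; apply: measurable_funX; apply: measurable_dotv.
    exact: measurable_cV_cst.
  exact: measurable_cV_id.
- by move=> v; rewrite lee_fin sqr_ge0.
set h : 'cV[R]_(1 + k) := col_mx L%:M 0.
transitivity (gauss_int (fun z : 'cV[R]_(1 + k) => ((dotv h z) ^+ 2)%:E)).
  by apply: eq_gauss_int => z; rewrite add0r dotv_whiten.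
rewrite (gauss_int_dotv h (f := fun x => (x ^+ 2)%:E)); last 2 first.
- by measurable_auto.
- by move=> x; rewrite lee_fin sqr_ge0.
rewrite /h dotv_col_mx dotv_scalar dot0v addr0 -expr2 sqrtr_sqr.
rewrite (ger0_norm L0) -[RHS]mule1 -normal_prob_sqr -ge0_integralZl; last 4 first.
- exact: measurableT.
- by measurable_auto.
- by move=> x _; rewrite lee_fin sqr_ge0.
- by rewrite lee_fin sqr_ge0.
by apply: eq_integral => x _; rewrite exprMn EFinM.
Qed.

(** The draws are added one at a time: variances add up by [gauss_int_sum],
    from [n] to [n + 1]. *)
Lemma sample_sum_law k (m : 'cV[R]_k) (C B : 'M[R]_k)
    (P : probability (k.-tuple R) R) n (g : 'cV[R]_k -> \bar R) :
  gaussian m C P -> B *m B^T = C -> B \in unitmx ->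
  measurable_on_cV g -> (forall v, 0 <= g v)%E ->
  (\int[product_prob P n]_X g (\sum_(i < n) vec_of_tuple (tnth X i))%R =
   gauss_int (fun z => g (n%:R *: m + Num.sqrt n%:R *: (B *m z))%R))%E.
Proof.
move=> gP BB uB; elim: n g => [|n IH] g mg g0.
  rewrite [RHS](_ : _ = g 0); last first.
    rewrite -[RHS](gauss_int_cst k); apply: eq_gauss_int => z.
    by rewrite sqrtr0 !scale0r addr0.
  rewrite (eq_integral (fun=> g 0)); first by rewrite integral_cst//= diracT mule1.
  by move=> X _; rewrite big_ord0.
have msum l : measurable_cV (fun X : l.-tuple (k.-tuple R) => \sum_(i < l) vec_of_tuple (tnth X i)).
  move=> j; under eq_fun do rewrite summxE.
  apply: measurable_sum => i; apply: measurable_cV_tuple; exact: measurable_tnth.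
rewrite integral_product_probS; last 2 first.
- exact: (measurable_on_cV_comp mg).
- by move=> X; exact: g0.
pose F (v : 'cV[R]_k) := gauss_int (fun z => g (v + (n%:R *: m + Num.sqrt n%:R *: (B *m z)))).
transitivity (\int[P]_x F (vec_of_tuple x))%E.
  apply: eq_integral => x _.
  rewrite /F -(IH (fun v => g (vec_of_tuple x + v))); last 2 first.
  - by apply: (measurable_on_cV_comp mg); apply: measurable_cVD;
      [exact: measurable_cV_cst|exact: measurable_cV_id].
  - by move=> v; exact: g0.
  apply: eq_integral => X _; rewrite big_ord_recl; congr g; congr (_ + _).
  by apply: eq_bigr => i _; rewrite tnthS.
rewrite (gaussian_integral gP BB uB); last 2 first.
- apply: (@measurable_gauss_int R _ (k.-tuple R) k (fun x z =>
    g (vec_of_tuple x + (n%:R *: m + Num.sqrt n%:R *: (B *m z))))); last by [].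
  apply: (measurable_on_cV_comp mg); apply: measurable_cVD; first exact: measurable_cV_tuple.
  apply: measurable_cVD; first exact: measurable_cV_cst.
  by apply: measurable_cVZ; apply: measurable_cV_mulmx; exact: measurable_cV_tuple.
- by move=> v; apply: gauss_int_ge0.
pose G (v : 'cV[R]_k) := g (n.+1%:R *: m + B *m v).
have mG : measurable_on_cV G.
  apply: (measurable_on_cV_comp mg); apply: measurable_cVD; first exact: measurable_cV_cst.
  by apply: measurable_cV_mulmx; exact: measurable_cV_id.
transitivity (gauss_int (fun v => gauss_int (fun w => G (1 *: v + Num.sqrt n%:R *: w)))).
  apply: eq_gauss_int => v; apply: eq_gauss_int => w; rewrite /G; congr g.
  rewrite scale1r mulmxDr -scalemxAr -natr1 scalerDl scale1r.
  by rewrite addrACA [m + _]addrC.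
rewrite (gauss_int_sum 1 (Num.sqrt n%:R) mG); last by move=> v; exact: g0.
apply: eq_gauss_int => z; rewrite /G; congr (g (_ + _)).
rewrite -scalemxAr; congr (Num.sqrt _ *: _).
by rewrite expr1n sqr_sqrtr ?ler0n// -natr1 addrC.
Qed.

Lemma acute_angleZ (c X : R) k (w : 'cV[R]_k) : 0 < c ->
  acute_angle (c * X) (c *: w) = acute_angle X w.
Proof.
move=> c0; rewrite /acute_angle scaler_eq0 gt_eqF//=; case: ifPn => // w0.
rewrite dotvZl dotvZr mulrA -expr2 sqrtrM ?sqr_ge0// sqrtr_sqr normrM.
by rewrite (gtr0_norm c0) -mulf_div divff ?mul1r// gt_eqF.
Qed.

(** Apart from the first coordinate [x], the event depends on [w . z] only,
    which is [|w|] times a standard normal variable.  The mass of the wedge is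
    then that of a planar sector, which shrinks when [X] is replaced with
    [|X|]. *)
Lemma gaussian_sector (X : R) k (w : 'cV[R]_(1 + k)) :
  ((acute_angle X w / (2 * pi))%:E <=
   gauss_int (fun y : 'cV[R]_(1 + (1 + k)) =>
     ((0 < y (lshift (1 + k) 0) 0) && (dotv (col_mx X%:M w) y < 0))%:R%:E))%E.
Proof.
set f := (X in gauss_int X).
have mf : measurable_on_cV f.
  apply/measurable_EFinP; apply: measurable_boolR; apply: measurable_and.
    by apply: measurable_fun_ltr => //; exact: measurable_cV_id.
  apply: measurable_fun_ltr => //; apply: measurable_dotv.
    exact: measurable_cV_cst.
  exact: measurable_cV_id.
have f0 v : (0 <= f v)%E by rewrite lee_fin ler0n.
have [w0|w0] := eqVneq w 0; first by rewrite /acute_angle w0 eqxx mul0r gauss_int_ge0.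
rewrite (gauss_intS mf f0) /acute_angle (negbTE w0).
set Y := Num.sqrt (dotv w w).
have Y0 : 0 < Y by rewrite sqrtr_gt0 lt0r dotv_eq0 w0 dotv_ge0.
have T0 : 0 <= `|X| / Y by rewrite divr_ge0// ltW.
rewrite -(normal_sector T0).
have mlt (x : R) : measurable_fun setT (fun t : R => (((0 < x) && (X * x + t < 0))%R%:R)%:E : \bar R).
  apply/measurable_EFinP; apply: measurable_boolR; apply: measurable_and => //.
  by apply: measurable_fun_ltr => //; exact: measurable_funD.
apply: ge0_le_integralT.
  by move=> x; apply: integral_ge0 => y _; rewrite lee_fin ler0n.
move=> x; apply: (@le_trans _ _ (\int[N01]_y ((0 < x) && (X * x + Y * y < 0)%R)%:R%:E)%E).
  apply: ge0_le_integralT => y; first by rewrite lee_fin ler0n.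
  rewrite lee_fin ler_nat; case: ltP => //= x0; case: ltP => //= yT.
  have : Y * y < - (`|X| * x).
    rewrite (_ : - (`|X| * x) = Y * - (`|X| / Y * x)) ?ltr_pM2l//.
    by field; rewrite gt_eqF.
  move=> Yy; rewrite (_ : X * x + Y * y < 0)//.
  rewrite addrC -ltrBrDr sub0r (lt_le_trans Yy)// lerN2.
  by rewrite ler_wpM2r ?ler_norm// ltW.
rewrite le_eqVlt; apply/orP; left; apply/eqP.
transitivity (gauss_int (fun z => (((0 < x) && (X * x + dotv w z < 0))%R%:R)%:E : \bar R)).
  by rewrite (gauss_int_dotv w (mlt x))// => t; rewrite lee_fin ler0n.
apply: eq_gauss_int => z; rewrite /f.
by rewrite (@dotv_col_mx R 1) dotv_scalar col_mxEu mxE eqxx mulr1n.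
Qed.

(** By [normal_tail_scale] with [T = 0], the mass of the negative half-line is
    the integral of the density over the positive one. *)
Lemma normal_half : (\int[N01]_x ((x < 0)%R%:R)%:E = (2^-1)%:E)%E.
Proof.
pose A : set R := [set y : R | y < 0].
have A1 : A = [set y | y < - (0 * 1)] by rewrite mul0r oppr0.
have mA : measurable A.
  by rewrite (_ : A = `]-oo, 0[%classic)//; apply/seteqP; split => y /=; rewrite in_itv.
have NA : N01 A = N01 (~` A).
  rewrite A1 normal_tail_scale// -A1 (_ : ~` A = `[0, +oo[%classic); last first.
    by apply/seteqP; split => y; rewrite /A/= in_itv/= andbT leNgt => /negP.
  by apply: eq_integral => y _; rewrite mul1r mulr1.
transitivity (N01 A); first exact: (integral_bool N01 mA).
have NC : N01 (~` A) = (1 - N01 A)%E by exact: (probability_setC N01 mA).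
move: NA; rewrite NC; have := fin_num_measure N01 A mA.
case: (N01 A) => // r _.
rewrite -EFinB => -[e]; congr EFin; lra.
Qed.

End gaussian_laws.

(** * The learning error of a linear rule *)

Section learning_error_bound.
Context {R : realType}.
Notation N01 := (normal_prob (0 : R) 1).

Lemma acute_angle_le_pihalf (X : R) k (w : 'cV[R]_k) : acute_angle X w <= pi / 2.
Proof.
rewrite /acute_angle; case: ifP => _; first by rewrite divr_ge0// pi_ge0.
by rewrite gerBl -(@atan0 R) le_atan// divr_ge0// sqrtr_ge0.
Qed.

Lemma learning_error_ge0 k (P1 P0 : probability (k.-tuple R) R) V W :
  0 <= learning_error P1 P0 V W.
Proof. by rewrite mulr_ge0// addr_ge0// fine_ge0. Qed.

Lemma halfspaceD k (F G s : 'cV[R]_k) :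
  halfspace F s `\` halfspace G s =
  [set x | (0 <= dotv F (vec_of_tuple x - s)) && (dotv G (vec_of_tuple x - s) < 0)].
Proof.
apply/seteqP; split => x /=.
  by move=> [Fx /negP]; rewrite -ltNge => Gx; apply/andP; split.
by move=> /andP[Fx Gx]; split => //; apply/negP; rewrite -ltNge.
Qed.

Lemma measurable_halfspaceD k (F G s : 'cV[R]_k) :
  measurable_fun setT (fun x : k.-tuple R =>
    (0 <= dotv F (vec_of_tuple x - s)) && (dotv G (vec_of_tuple x - s) < 0)).
Proof.
have md H : measurable_fun setT (fun x : k.-tuple R => dotv H (vec_of_tuple x - s)).
  apply: measurable_dotv; first exact: measurable_cV_cst.
  by apply: measurable_cVD; [exact: measurable_cV_id|exact: measurable_cV_cst].
apply: measurable_and; first exact: measurable_fun_ler.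
exact: measurable_fun_ltr.
Qed.

(** In whitened coordinates centred at [s] the law is a standard Gaussian
    translated by [h]; Cameron-Martin moves the translation into a density. *)
Lemma gaussian_wedge k (m s : 'cV[R]_k) (C B : 'M[R]_k) (a b h : 'cV[R]_k)
    (P : probability (k.-tuple R) R) :
  gaussian m C P -> B *m B^T = C -> B \in unitmx -> C \in unitmx ->
  m - s = B *m h ->
  P (halfspace (invmx C *m (B *m a)) s `\` halfspace (invmx C *m (B *m b)) s) =
  gauss_int (fun y => ((0 <= dotv a y) && (dotv b y < 0))%:R%:E * (shift_density h y)%:E)%E.
Proof.
move=> gP BB uB uC ms.
rewrite halfspaceD.
set F := invmx C *m _; set G := invmx C *m _.
rewrite (gaussian_bool (b := fun v => (0 <= dotv F (v - s)) && (dotv G (v - s) < 0))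
  gP BB uB (measurable_halfspaceD F G s)).
rewrite -(gauss_int_shift h (f := fun y => ((0 <= dotv a y) && (dotv b y < 0))%:R%:E));
  last 2 first.
- apply/measurable_EFinP; apply: measurable_boolR; apply: measurable_and.
    by apply: measurable_fun_ler => //; apply: measurable_dotv;
      [exact: measurable_cV_cst|exact: measurable_cV_id].
  by apply: measurable_fun_ltr => //; apply: measurable_dotv;
    [exact: measurable_cV_cst|exact: measurable_cV_id].
- by move=> v; rewrite lee_fin ler0n.
apply: eq_gauss_int => z; have -> : m + B *m z - s = B *m (z + h).
  by rewrite mulmxDr -ms addrA [m + _]addrC.
by rewrite !dotv_whiten.
Qed.

Lemma gauss_int_opp k (g : 'cV[R]_k -> \bar R) :
  measurable_on_cV g -> (forall v, 0 <= g v)%E -> gauss_int (fun v => g (- v)) = gauss_int g.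
Proof.
move=> mg g0; rewrite -(@gauss_int_orth _ _ (- 1%:M) g)//.
  by apply: eq_gauss_int => v; rewrite mulNmx mul1mx.
have -> : (- 1%:M)^T = - 1%:M :> 'M[R]_k.
  by apply/matrixP => i j; rewrite !mxE eq_sym.
by rewrite mulNmx mulmxN opprK mul1mx.
Qed.

(** On [y1 > 0] the density [exp (L y1 / 2 - L^2 / 8)] is at least
    [exp (- L^2 / 8)].  The predicate [b] is kept abstract because the two
    misclassification events contain the open wedge but have different
    boundaries. *)
Lemma gauss_wedge_lb k (X L : R) (w : 'cV[R]_(1 + k))
    (b : 'cV[R]_(1 + (1 + k)) -> bool) :
  let u := col_mx X%:M w in let h := col_mx L%:M 0 : 'cV[R]_(1 + (1 + k)) in
  0 <= L -> measurable_fun setT (fun x => b (vec_of_tuple x)) ->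
  (forall y : 'cV[R]_(1 + (1 + k)),
    0 < y (lshift (1 + k) 0) 0 -> dotv u y < 0 -> b y) ->
  ((expR (- (L ^+ 2 / 8)) * (acute_angle X w / (2 * pi)))%:E <=
   gauss_int (fun y => (b y)%:R%:E * (shift_density (2^-1 *: h) y)%:E))%E.
Proof.
move=> u h L0 mb bP; rewrite EFinM.
set kap := expR _; have k0 : (0 <= kap%:E)%E by rewrite lee_fin expR_ge0.
pose f (y : 'cV[R]_(1 + (1 + k))) : \bar R :=
  ((0 < y (lshift (1 + k) 0) 0) && (dotv u y < 0))%:R%:E.
have mf : measurable_on_cV f.
  apply/measurable_EFinP; apply: measurable_boolR; apply: measurable_and.
    by apply: measurable_fun_ltr => //; exact: measurable_cV_id.
  by apply: measurable_fun_ltr => //; apply: measurable_dotv;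
    [exact: measurable_cV_cst|exact: measurable_cV_id].
have f0 v : (0 <= f v)%E by rewrite lee_fin ler0n.
apply: (@le_trans _ _ (kap%:E * gauss_int f)%E).
  by apply: lee_wpmul2l => //; exact: gaussian_sector.
rewrite -(gauss_intZl mf f0 k0); apply: le_gauss_int.
- exact: emeasurable_funM.
- apply: emeasurable_funM; apply/measurable_EFinP; first exact: measurable_boolR.
  by apply: measurable_shift_density; [exact: measurable_cV_cst|exact: measurable_cV_id].
- by move=> y; rewrite mule_ge0.
- move=> y; rewrite -!EFinM lee_fin /f.
  case: (ltP 0 (y (lshift (1 + k) 0) 0)) => [y0|_]/=; last first.
    by rewrite mulr0 mulr_ge0 ?ler0n ?shift_density_ge0.
  case: (ltP (dotv u y) 0) => [uy|_]/=; last first.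
    by rewrite mulr0 mulr_ge0 ?ler0n ?shift_density_ge0.
  rewrite (bP _ y0 uy) mul1r mulr1 ler_expR.
  rewrite !dotvZl dotvZr [in dotv h y](cV_split y) /h !dotv_col_mx !dotv_scalar.
  rewrite !dot0v !addr0.
  have Ly : 0 <= L * y (lshift (1 + k) 0) 0 by rewrite mulr_ge0// ltW.
  by rewrite expr2; lra.
Qed.

(** The probability of each of the two misclassification events has the
    required lower bound.  That of the second class is brought back to the
    first by [y |-> - y], which exchanges the strict and large inequalities. *)
Lemma learning_error_lb k (C B : 'M[R]_(1 + (1 + k)))
    (mu1 mu0 : 'cV[R]_(1 + (1 + k))) (L X : R) (w : 'cV[R]_(1 + k))
    (P1 P0 : probability ((1 + (1 + k)).-tuple R) R) :
  posdef C -> gaussian mu1 C P1 -> gaussian mu0 C P0 -> 0 <= L ->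
  B *m B^T = C -> B \in unitmx -> mu1 - mu0 = B *m col_mx L%:M 0 ->
  expR (- (L ^+ 2 / 8)) / (2 * pi) * acute_angle X w <=
  learning_error P1 P0
    (halfspace (invmx C *m (mu1 - mu0)) (2^-1 *: (mu1 + mu0)))
    (halfspace (invmx C *m (B *m col_mx X%:M w)) (2^-1 *: (mu1 + mu0))).
Proof.
move=> pC gP1 gP0 L0 BB uB mE; have uC := posdef_unit pC.
set h : 'cV[R]_(1 + (1 + k)) := col_mx L%:M 0 in mE *; set u := col_mx X%:M w.
set s := 2^-1 *: (mu1 + mu0).
have half (v : 'cV[R]_(1 + (1 + k))) : v - 2^-1 *: v = 2^-1 *: v.
  by rewrite -{1}[v]scale1r -scalerBl; congr (_ *: _); field.
have s1 : mu1 - s = B *m (2^-1 *: h).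
  by rewrite -scalemxAr -mE /s scalerDr opprD addrA half -scalerBr.
have s0 : mu0 - s = B *m (- (2^-1 *: h)).
  rewrite mulmxN -scalemxAr -mE /s scalerDr opprD addrCA half addrC.
  by rewrite -scalerBr -scalerN opprB.
set V := halfspace _ s; set W := halfspace _ s.
have fin1 A (P : probability ((1 + (1 + k)).-tuple R) R) : measurable A ->
    P A \is a fin_num by move=> mA; exact: fin_num_measure.
have mVW F G : measurable (halfspace F s `\` halfspace G s).
  rewrite halfspaceD -[X in measurable X]setTI.
  by have mb := measurable_halfspaceD F G s; exact: (mb measurableT [set true]).
have mb a b : measurable_fun setT (fun x : (1 + (1 + k)).-tuple R =>
    (0 <= dotv a (vec_of_tuple x)) && (dotv b (vec_of_tuple x) < 0)).
  have := measurable_halfspaceD a b 0.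
  by under eq_fun do rewrite !subr0.
have hy y : dotv h y = L * y (lshift (1 + k) 0) 0.
  by rewrite [in LHS](cV_split y) /h dotv_col_mx dotv_scalar dot0v addr0.
have PV : P1 (V `\` W) =
    gauss_int (fun y => ((0 <= dotv h y) && (dotv u y < 0))%:R%:E * (shift_density (2^-1 *: h) y)%:E)%E.
  by rewrite /V mE; exact: (gaussian_wedge h u gP1 BB uB uC s1).
(* If the classes coincide, [V] is the whole space and the second event is
   empty; the first one is a half-space through the mean, of mass [1 / 2],
   which is twice the largest possible value of the angle over [2 pi]. *)
have [L00|Lneq0] := eqVneq L 0.
  have [w0|w0] := eqVneq w 0.
    by rewrite /acute_angle w0 eqxx mulr0 learning_error_ge0.
  have h0 : h = 0 by rewrite /h L00 (_ : 0%:M = 0) ?col_mx0//; apply/matrixP => i j;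
    rewrite !mxE mul0rn.
  have uu : 0 < dotv u u.
    rewrite lt0r dotv_ge0 dotv_eq0 andbT; apply: contra_neq w0.
    by move/(congr1 (@dsubmx _ 1 (1 + k) 1)); rewrite col_mxKd linear0.
  have P1h : P1 (V `\` W) = (2^-1)%:E.
    rewrite PV -normal_half.
    transitivity (gauss_int (fun y => ((dotv u y < 0)%R%:R)%:E : \bar R)).
      apply: eq_gauss_int => y; rewrite h0 scaler0 dot0v lexx/=.
      by rewrite /shift_density !dot0v mul0r subrr expR0 mule1.
    rewrite (gauss_int_dotv u (f := fun t => ((t < 0)%R%:R)%:E)); last 2 first.
    - by apply/measurable_EFinP; apply: measurable_boolR; exact: measurable_fun_ltr.
    - by move=> t; rewrite lee_fin ler0n.
    by apply: eq_integral => t _; rewrite pmulr_rlt0// sqrtr_gt0.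
  rewrite /learning_error P1h /= L00 expr0n mul0r oppr0 expR0.
  have P00 : 0 <= fine (P0 (W `\` V)) by rewrite fine_ge0.
  have pi0 : (0 : R) < pi by exact: pi_gt0.
  apply: (@le_trans _ _ (2^-1 * 2^-1)); last by rewrite ler_pM2l// lerDl.
  rewrite mulrAC mul1r ler_pdivrMr ?mulr_gt0//.
  apply: (le_trans (acute_angle_le_pihalf _ _)); lra.
have Lgt0 : 0 < L by rewrite lt_neqAle eq_sym Lneq0.
set r := _ * acute_angle X w.
have rE : r = expR (- (L ^+ 2 / 8)) * (acute_angle X w / (2 * pi)) by rewrite /r mulrA mulrAC.
have r1 : (r%:E <= P1 (V `\` W))%E.
  rewrite PV rE; apply: (gauss_wedge_lb L0 (mb h u)) => y y0 uy.
  by rewrite uy andbT hy mulr_ge0// ltW.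
have r0 : (r%:E <= P0 (W `\` V))%E.
  rewrite /V mE (gaussian_wedge u h gP0 BB uB uC s0) -gauss_int_opp; last 2 first.
  - apply: emeasurable_funM; apply/measurable_EFinP; first exact: measurable_boolR.
    by apply: measurable_shift_density; [exact: measurable_cV_cst|exact: measurable_cV_id].
  - by move=> v; rewrite mule_ge0// lee_fin ?ler0n ?shift_density_ge0.
  rewrite rE (eq_gauss_int (g := fun y => (((0 <= dotv (- u) y) && (dotv (- h) y < 0))%:R%:E *
      (shift_density (2^-1 *: h) y)%:E)%E)); last first.
    by move=> y; rewrite !dotvNr !dotvNl /shift_density !(dotvNr, dotvNl) !opprK.
  apply: (gauss_wedge_lb L0 (mb (- u) (- h))) => y y0 uy.
  by rewrite !dotvNl oppr_ge0 ltW//= hy oppr_lt0 mulr_gt0.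
have e1 : r <= fine (P1 (V `\` W)) by rewrite -lee_fin fineK//; apply: fin1; exact: mVW.
have e0 : r <= fine (P0 (W `\` V)) by rewrite -lee_fin fineK//; apply: fin1; exact: mVW.
rewrite /learning_error; lra.
Qed.

End learning_error_bound.

Theorem proposition2p2 (R : realType) (p n : nat) (hp : (3 < p)%N) (hn : (0 < n)%N)
    (C : 'M[R]_p) (hC : posdef C) (mu1 mu0 : 'cV[R]_p)
    (P1 P0 P gammaC : probability (p.-tuple R) R)
    (hP1 : gaussian mu1 C P1) (hP0 : gaussian mu0 C P0)
    (hP : gaussian (mu1 - mu0) C P) (hgammaC : gaussian 0 C gammaC) :
  let m10 := mu1 - mu0 in
  let s10 := 2^-1 *: (mu1 + mu0) in
  let F10 := invmx C *m m10 in
  let V := halfspace F10 s10 in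
  let Fhat (X : n.-tuple (p.-tuple R)) := invmx C *m empirical_mean X in
  let Vhat (X : n.-tuple (p.-tuple R)) := halfspace (Fhat X) s10 in
  ((acos ((Num.sqrt (p%:R - 3))^-1 * (Num.sqrt n%:R * L2norm gammaC F10 + 1))
      / (2 * pi) * expR (- (L2norm gammaC F10 ^+ 2 / 8)))%:E
   <= 'E_(product_prob P n)[(fun X => learning_error P1 P0 V (Vhat X))])%E.
Proof.
case: p hp C hC mu1 mu0 P1 P0 P gammaC hP1 hP0 hP hgammaC => [|[|[|[|k]]]]// _.
(* One coordinate along the mean difference, and [k + 3 = p - 1] others; the
   constant [p - 3] is [k + 1]. *)
change (k.+4) with (1 + (1 + k.+2))%N.
move=> C pC mu1 mu0 P1 P0 P gammaC gP1 gP0 gP gC; cbv zeta.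
set F10 := invmx C *m (mu1 - mu0).
have [A AA _] := gP1; have [B [L [L0 BB uB mE]]] := whitening (mu1 - mu0) pC AA.
have uC := posdef_unit pC.
set h : 'cV[R]_(1 + (1 + k.+2)) := col_mx L%:M 0 in mE.
have -> : L2norm gammaC F10 = L by rewrite /F10 mE; exact: (L2norm_gaussian gC BB uB uC L0).
have -> : (1 + (1 + k.+2))%:R - 3 = k.+1%:R :> R.
  by rewrite (_ : (1 + (1 + k.+2) = k.+1 + 3)%N) ?natrD ?addrK// addn3.
rewrite expectation.unlock; set rn := Num.sqrt n%:R.
have n0 : 0 < n%:R :> R by rewrite ltr0n.
have rn0 : 0 < rn by rewrite sqrtr_gt0.
set kap := expR (- (L ^+ 2 / 8)) / (2 * pi).
have kap0 : 0 <= kap by rewrite divr_ge0 ?expR_ge0// mulr_ge0// pi_ge0.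
pose U (v : 'cV[R]_(1 + (1 + k.+2))) := invmx B *m (n%:R^-1 *: v).
pose g v : \bar R := (kap * acute_angle (U v (lshift (1 + k.+2) 0) 0) (dsubmx (U v)))%:E.
have mU d (T : measurableType d) (G : T -> 'cV[R]_(1 + (1 + k.+2))) :
    measurable_cV G -> measurable_cV (fun t => U (G t)).
  by move=> mG; apply: measurable_cV_mulmx; exact: measurable_cVZ.
have mg : measurable_on_cV g.
  apply/measurable_EFinP; apply: measurable_funM => //; apply: measurable_acute_angle.
    exact: (mU _ _ _ (@measurable_cV_id R _)).
  by apply: measurable_cV_dsubmx; exact: (mU _ _ _ (@measurable_cV_id R _)).
have g0 v : (0 <= g v)%E by rewrite lee_fin mulr_ge0// acute_angle_ge0.
apply: (@le_trans _ _ (\int[product_prob P n]_X g (\sum_(i < n) vec_of_tuple (tnth X i))%R)%E);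
  last first.
  apply: ge0_le_integralT => [X|X]; first exact: g0.
  rewrite lee_fin /g; set v := \sum_(i < n) _.
  have xE : empirical_mean X = B *m col_mx (U v (lshift (1 + k.+2) 0) 0)%:M (dsubmx (U v)).
    by rewrite -cV_split /U mulKVmx.
  rewrite xE.
  exact: (learning_error_lb _ _ pC gP1 gP0 L0 BB uB mE).
rewrite (sample_sum_law n gP BB uB mg g0).
pose f (z : 'cV[R]_(1 + (1 + k.+2))) : \bar R :=
  (kap * acute_angle (rn * L + z (lshift (1 + k.+2) 0) 0) (dsubmx z))%:E.
have gf z : g (n%:R *: (mu1 - mu0) + rn *: (B *m z)) = f z.
  have -> : g (n%:R *: (mu1 - mu0) + rn *: (B *m z)) =
     (kap * acute_angle (rn^-1 * (rn * L + z (lshift (1 + k.+2) 0) 0)) (rn^-1 *: dsubmx z))%:E.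
    have UE : U (n%:R *: (mu1 - mu0) + rn *: (B *m z)) = rn^-1 *: (rn *: h + z).
      rewrite /U mE !scalemxAr -mulmxDr scalemxAr mulKmx// !scalerDr !scalerA.
      have nE : n%:R = rn * rn by rewrite -expr2 sqr_sqrtr// ltW.
      by congr (_ *: _ + _ *: _); rewrite nE; field; rewrite gt_eqF.
    have U0 : (rn^-1 *: (rn *: h + z)) (lshift (1 + k.+2) 0) 0 =
        rn^-1 * (rn * L + z (lshift (1 + k.+2) 0) 0).
      by rewrite !mxE (unsplitK (inl _)) mxE eqxx mulr1n.
    have U1 : dsubmx (rn^-1 *: (rn *: h + z)) = rn^-1 *: dsubmx z.
      by rewrite linearZ/= linearD/= linearZ/= col_mxKd scaler0 add0r.
    by rewrite /g UE U0 U1.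
  (* The whitened mean is [rn^-1] times a unit-variance vector, and the angle
     does not see the factor. *)
  by rewrite acute_angleZ ?invr_gt0.
rewrite (eq_gauss_int gf) gauss_intS; last 2 first.
- apply/measurable_EFinP; apply: measurable_funM => //; apply: measurable_acute_angle.
    by apply: measurable_funD => //; exact: measurable_cV_id.
  by apply: measurable_cV_dsubmx; exact: measurable_cV_id.
- by move=> z; rewrite lee_fin mulr_ge0// acute_angle_ge0.
have mang (x : R) : measurable_on_cV (fun w : 'cV[R]_(k.+3) => (acute_angle (rn * L + x) w)%:E).
  by apply/measurable_EFinP; apply: measurable_acute_angle;
    [exact: measurable_cst|exact: measurable_cV_id].
have ang0 (x : R) (w : 'cV[R]_(k.+3)) : (0 <= (acute_angle (rn * L + x) w)%:E)%E.
  by rewrite lee_fin acute_angle_ge0.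
have fE : (\int[normal_prob (0 : R) 1]_x gauss_int (fun w : 'cV[R]_(k.+3) => f (col_mx x%:M w)) =
    \int[normal_prob (0 : R) 1]_x (kap%:E *
      gauss_int (fun w : 'cV[R]_(k.+3) => (acute_angle (rn * L + x) w)%:E)))%E.
  apply: eq_integral => x _; rewrite -gauss_intZl; last 3 first.
  - exact: mang.
  - exact: ang0.
  - by rewrite lee_fin.
  apply: eq_gauss_int => w.
  by rewrite /f (@col_mxEu _ 1) mxE eqxx mulr1n (@col_mxKd _ 1).
apply: (@le_trans _ _ (\int[normal_prob (0 : R) 1]_x (kap%:E *
      gauss_int (fun w : 'cV[R]_(k.+3) => (acute_angle (rn * L + x) w)%:E)))%E); last first.
  by rewrite -fE.
rewrite ge0_integralZl; last 4 first.
- exact: measurableT.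
- apply: (@measurable_gauss_int R _ R k.+3 (fun x w => (acute_angle (rn * L + x) w)%:E)) => //.
  apply/measurable_EFinP; apply: measurable_acute_angle; last exact: measurable_cV_tuple.
  exact: measurable_funD.
- by move=> x _; exact: gauss_int_ge0.
- by rewrite lee_fin.
have a0 : 0 <= rn * L by rewrite mulr_ge0// ltW.
apply: le_trans (lee_wpmul2l _ (gauss_int_angle k a0)); last by rewrite lee_fin.
rewrite -EFinM lee_fin; set b := _ * (rn * L + 1).
have b0 : 0 <= b by rewrite mulr_ge0 ?invr_ge0 ?sqrtr_ge0// addr_ge0.
rewrite (_ : _ * expR _ = kap * acos b); last by rewrite /kap; ring.
by apply: ler_wpM2l => //; exact: acos_le_atan.
Qed.
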